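(* Let $\alpha\ge0$, $\widetilde{\Gamma}=\widetilde{\Omega}+\alpha\cdot\mathbf{I}$, $N_0\ge1$ an integer, $\eta\in(0,1]$, $\delta\in[0,\infty)$, and let $\{X^{(k)}\}_{k\ge0}$ be a sequence of iterates generated by either $\mathsf{AGPM\text{-}PGO}$ or $\mathsf{AGPM\text{-}PGO^*}$ (defined in the context). Then: (a) there is $F^\infty\in\mathbb{R}$ such that $F(X^{(k)})\to F^\infty$ as $k\to\infty$; (b) $\|X^{(k+1)}-X^{(k)}\|\to0$ as $k\to\infty$ if $\widetilde{\Gamma}\succ\widetilde{M}$ and $\delta>0$; (c) $\mathrm{grad}\,F(X^{(k)})\to\mathbf{0}$ as $k\to\infty$ if $\widetilde{\Gamma}\succ\widetilde{M}$, $\delta>0$ and $N_0=1$; (d) $\|X^{(k+1)}-X^{(k)}\|\to0$ as $k\to\infty$ if $\alpha>0$ and $\delta>0$; (e) $\mathrm{grad}\,F(X^{(k)})\to\mathbf{0}$ as $k\to\infty$ if $\alpha>0$, $\delta>0$ and $N_0=1$.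
   Context: **Pose graph optimization (PGO) data.** Integers $d\ge 1$, $n\ge 2$; a weakly connected directed graph with vertex set $\mathcal{V}=\{1,\dots,n\}$ and edge set $\overrightarrow{\mathcal{E}}\subset\mathcal{V}\times\mathcal{V}$ (no self-loops); for each $(i,j)\in\overrightarrow{\mathcal{E}}$, a measurement $\widetilde{R}_{ij}\in SO(d)$, $\tilde{t}_{ij}\in\mathbb{R}^d$ and weights $\kappa_{ij}\ge 0$, $\tau_{ij}>0$. Variables are written as $X=\begin{bmatrix} t&R\end{bmatrix}=\begin{bmatrix} t_1&\cdots&t_n&R_1&\cdots&R_n\end{bmatrix}\in\mathbb{R}^{d\times(d+1)n}$ with $t_i\in\mathbb{R}^d$, $R_i\in\mathbb{R}^{d\times d}$; $\mathbb{R}^{d\times n}\times SO(d)^n$ is the submanifold of $\mathbb{R}^{d\times(d+1)n}$ of those $X$ with all $R_i\in SO(d)$. $\|\cdot\|$ is the Frobenius norm. The PGO objective is $$F(X)=\sum_{(i,j)\in\overrightarrow{\mathcal{E}}}\tfrac12\Big(\kappa_{ij}\|R_i\widetilde{R}_{ij}-R_j\|^2+\tau_{ij}\|R_i\tilde{t}_{ij}+t_i-t_j\|^2\Big)=\tfrac12\,\mathrm{trace}(X\widetilde{M}X^\top),$$ where $\widetilde{M}\in\mathbb{R}^{(d+1)n\times(d+1)n}$ is the unique symmetric (positive semidefinite) matrix for which this identity holds for all $X\in\mathbb{R}^{d\times(d+1)n}$; write $\widetilde{M}=\begin{bmatrix} L&\widetilde{V}\\ \widetilde{V}^\top& *\end{bmatrix}$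 with $L\in\mathbb{R}^{n\times n}$, $\widetilde{V}\in\mathbb{R}^{n\times dn}$. The Euclidean gradient is $\nabla F(X)=X\widetilde{M}$ (for all $X\in\mathbb{R}^{d\times(d+1)n}$). $\mathrm{grad}\,F(X)$ is the Riemannian gradient of $F$ on $\mathbb{R}^{d\times n}\times SO(d)^n$ (embedded submanifold with the Frobenius inner product), i.e. the orthogonal projection of $\nabla F(X)$ onto the tangent space at $X$. $A\succeq B$ (resp. $A\succ B$) means $A-B$ is symmetric positive semidefinite (resp. definite). **Matrices.** $\widetilde{\Omega}$ is the symmetric matrix with $\tfrac12\mathrm{trace}(X\widetilde{\Omega}X^\top)=\sum_{(i,j)\in\overrightarrow{\mathcal{E}}}\big(\kappa_{ij}(\|R_i\|^2+\|R_j\|^2)+\tau_{ij}(\|R_i\tilde{t}_{ij}+t_i\|^2+\|t_j\|^2)\big)$ for all $X\in\mathbb{R}^{d\times(d+1)n}$. With $\alpha\ge0$ and $\widetilde{\Gamma}=\widetilde{\Omega}+\alpha\mathbf{I}$ one has the block form $\widetilde{\Gamma}=\begin{bmatrix}\Gamma^\tau&(\widetilde{\Gamma}^\nu)^\top\\ \widetilde{\Gamma}^\nu&\widetilde{\Gamma}^\rho\end{bmatrix}$ with $\Gamma^\tau=\mathrm{diag}\{\Gamma^\tau_i\}$, $\widetilde{\Gamma}^\nu=\mathrm{diag}\{\widetilde{\Gamma}^\nu_i\}$, $\widetilde{\Gamma}^\rho=\mathrm{diag}\{\widetilde{\Gamma}^\rho_i\}$ (block diagonal), $$\Gamma_i^\tau=\alpha+\sum_{e\ni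 i}2\tau_e\in\mathbb{R},\quad \widetilde{\Gamma}_i^\rho=\alpha\mathbf{I}+\sum_{e\ni i}2\kappa_e\mathbf{I}+\sum_{j:(i,j)\in\overrightarrow{\mathcal{E}}}2\tau_{ij}\tilde{t}_{ij}\tilde{t}_{ij}^\top\in\mathbb{R}^{d\times d},\quad \widetilde{\Gamma}_i^\nu=\sum_{j:(i,j)\in\overrightarrow{\mathcal{E}}}2\tau_{ij}\tilde{t}_{ij}\in\mathbb{R}^d,$$ where $\sum_{e\ni i}$ runs over edges of $\overrightarrow{\mathcal{E}}$ having $i$ as an endpoint (either orientation). **Elementary steps.** For $Y=\begin{bmatrix}t^Y&R^Y\end{bmatrix}\in\mathbb{R}^{d\times(d+1)n}$ (not necessarily with $R_i^Y\in SO(d)$) write $\nabla F(Y)=Y\widetilde{M}=\begin{bmatrix}\overline{\gamma}^\tau_1&\cdots&\overline{\gamma}^\tau_n&\overline{\gamma}^\rho_1&\cdots&\overline{\gamma}^\rho_n\end{bmatrix}$ with $\overline{\gamma}^\tau_i\in\mathbb{R}^d$, $\overline{\gamma}^\rho_i\in\mathbb{R}^{d\times d}$. - Unstarred step $Y\mapsto X^+=\begin{bmatrix}t^+&R^+\end{bmatrix}$: $\theta_i=R_i^Y\big(\widetilde{\Gamma}_i^\rho-\widetilde{\Gamma}_i^\nu(\Gamma_i^\tau)^{-1}(\widetilde{\Gamma}_i^\nu)^\top\big)+\overline{\gamma}_i^\tau(\Gamma_i^\tau)^{-1}(\widetilde{\Gamma}_i^\nu)^\top-\overline{\gamma}_i^\rho$,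 $R_i^+\in\arg\max_{R_i\in SO(d)}\mathrm{trace}(R_i^\top\theta_i)$, $t_i^+=t_i^Y-R_i^+\widetilde{\Gamma}_i^\nu(\Gamma_i^\tau)^{-1}+(R_i^Y\widetilde{\Gamma}_i^\nu-\overline{\gamma}_i^\tau)(\Gamma_i^\tau)^{-1}$. (Equivalently, $X^+$ minimizes $F(Y)+\mathrm{trace}((X-Y)^\top\nabla F(Y))+\frac12\mathrm{trace}((X-Y)\widetilde{\Gamma}(X-Y)^\top)$ over $X\in\mathbb{R}^{d\times n}\times SO(d)^n$.) - Starred step $Y\mapsto X^+$: $\theta_i=R_i^Y\big(\widetilde{\Gamma}_i^\rho-\widetilde{\Gamma}_i^\nu(\Gamma_i^\tau)^{-1}(\widetilde{\Gamma}_i^\nu)^\top\big)-\overline{\gamma}_i^\rho$, $R_i^+\in\arg\max_{R_i\in SO(d)}\mathrm{trace}(R_i^\top\theta_i)$, $t^+=-R^+\widetilde{V}^\top L^\dagger$ ($\dagger$ = Moore–Penrose pseudoinverse). Any maximizer may be chosen when an argmax is not unique. **Inner methods.** - $\mathsf{GPM\text{-}PGO}(Z^{(0)},N_0)$ (resp. $\mathsf{GPM\text{-}PGO^*}(Z^{(0)},N_0)$) returns $Z^{(0)},\dots,Z^{(N_0)}$, where $Z^{(i+1)}$ is obtained from $Z^{(i)}$ by the unstarred (resp. starred) step. - $\mathsf{NAG\text{-}PGO}(V^{(0)},V^{(-1)},s^{(0)},N_0)$ (resp. $\mathsf{NAG\text{-}PGO^*}(V^{(0)},V^{(-1)},s^{(0)},N_0)$),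 with $s^{(0)}\ge1$, returns $\{V^{(i)},s^{(i)}\}_{i\le N_0}$, where for $i=0,\dots,N_0-1$ $$s^{(i+1)}=\frac{\sqrt{4(s^{(i)})^2+1}+1}{2},\qquad Y^{(i)}=V^{(i)}+\frac{s^{(i)}-1}{s^{(i+1)}}\big(V^{(i)}-V^{(i-1)}\big),$$ and $V^{(i+1)}$ is obtained from $Y^{(i)}$ by the unstarred (resp. starred) step. **Outer methods.** $\mathsf{AGPM\text{-}PGO}$ starts from any $X^{(0)}\in\mathbb{R}^{d\times n}\times SO(d)^n$; $\mathsf{AGPM\text{-}PGO^*}$ starts from $X^{(0)}=\begin{bmatrix}t^{(0)}&R^{(0)}\end{bmatrix}$ with $R^{(0)}\in SO(d)^n$, $t^{(0)}=-R^{(0)}\widetilde{V}^\top L^\dagger$. Parameters: $N_0\ge1$, $\eta\in(0,1]$, $\delta\ge0$. Set $a^{(0)}=1$, $T^{(0)}=X^{(0)}$, $f^{(0)}=F(X^{(0)})$. For $k=0,1,2,\dots$ (run indefinitely): 1. Compute $\{V^{(i)},s^{(i)}\}$ by $\mathsf{NAG\text{-}PGO}(X^{(k)},T^{(k)},a^{(k)},N_0)$ (for $\mathsf{AGPM\text{-}PGO^*}$: by $\mathsf{NAG\text{-}PGO^*}$ with the same arguments). 2. If $F(V^{(N_0)})\le f^{(k)}-\delta\|V^{(N_0)}-X^{(k)}\|^2$, set $a^{(k+1)}=s^{(N_0)}$, $X^{(k+1)}=V^{(N_0)}$, $T^{(k+1)}=V^{(N_0-1)}$. 3. Otherwise compute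 $\{Z^{(i)}\}$ by $\mathsf{GPM\text{-}PGO}(X^{(k)},N_0)$ (for $\mathsf{AGPM\text{-}PGO^*}$: by $\mathsf{GPM\text{-}PGO^*}$) and set $a^{(k+1)}=1$, $X^{(k+1)}=Z^{(N_0)}$, $T^{(k+1)}=Z^{(N_0)}$. 4. Set $f^{(k+1)}=(1-\eta)f^{(k)}+\eta F(X^{(k+1)})$. *)

(* Defs.v *)
(* MathComp + MathComp-Analysis; R : realType is the field of real numbers. *)
From HB Require Import structures.
From mathcomp Require Import all_boot all_order all_algebra.
From mathcomp Require Import boolp classical_sets functions reals.
From mathcomp Require Import topology normedtype sequences.

Set Implicit Arguments.
Unset Strict Implicit.
Unset Printing Implicit Defensive.

Import Order.TTheory GRing.Theory Num.Theory.
Import numFieldNormedType.Exports.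
Local Open Scope classical_set_scope.
Local Open Scope ring_scope.

Section MatrixPreliminaries.
Variable R : realType.

Definition frob_inner m p (A B : 'M[R]_(m, p)) : R := \tr (A *m B^T).

(* The library norm on matrices is the max norm, hence this definition. *)
Definition frob_norm m p (A : 'M[R]_(m, p)) : R := Num.sqrt (frob_inner A A).

Definition posdef m (A : 'M[R]_m) : Prop :=
  A^T = A /\ forall x : 'cV[R]_m, x != 0 -> 0 < (x^T *m A *m x) 0 0.

Definition SO (d : nat) : set 'M[R]_d := [set Q | Q *m Q^T = 1%:M /\ \det Q = 1].

(* The Penrose equations: B is the Moore-Penrose pseudoinverse of A. *)
Definition moore_penrose m p (A : 'M[R]_(m, p)) (B : 'M[R]_(p, m)) : Prop :=
  [/\ A *m B *m A = A, B *m A *m B = B,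
      (A *m B)^T = A *m B & (B *m A)^T = B *m A].

(* A is the (unique) symmetric matrix such that Q X = tr (X A X^T) / 2. *)
Definition form_matrix m p (Q : 'M[R]_(m, p) -> R) (A : 'M[R]_p) : Prop :=
  A^T = A /\ forall X, Q X = 2^-1 * \tr (X *m A *m X^T).

End MatrixPreliminaries.

(* X = [t_1 ... t_n R_1 ... R_n]: the block [R_1 ... R_n] is a library block
   row, whose width is the sum of n terms d. *)
Notation pose_dim d n := (n + \sum_(i < n) d)%N.
Notation pose_mx R d n := 'M[R]_(d, pose_dim d n).

(* Weights and measurements are indexed by pairs of vertices, but only their
   values on the edges matter. *)
Record pgo_data (R : realType) (d n : nat) := PgoData {
  edges : {set 'I_n * 'I_n};
  meas_rot : 'I_n * 'I_n -> 'M[R]_d;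
  meas_trans : 'I_n * 'I_n -> 'cV[R]_d;
  kappa : 'I_n * 'I_n -> R;
  tau : 'I_n * 'I_n -> R;
  edges_noloop : forall e, e \in edges -> e.1 != e.2;
  edges_connected : forall i j : 'I_n,
    connect (fun x y => ((x, y) \in edges) || ((y, x) \in edges)) i j;
  meas_rotP : forall e, e \in edges -> SO (meas_rot e);
  kappa_ge0 : forall e, e \in edges -> 0 <= kappa e;
  tau_gt0 : forall e, e \in edges -> 0 < tau e
}.

Section PoseGraph.
Variables (R : realType) (d n : nat) (D : pgo_data R d n).
Implicit Types (X Y G H : pose_mx R d n) (M : 'M[R]_(pose_dim d n)).

Definition tr_part X : 'M[R]_(d, n) := lsubmx X.
Definition rot_part X : 'M[R]_(d, \sum_(i < n) d) := rsubmx X.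
Definition tr_of X (i : 'I_n) : 'cV[R]_d := col i (tr_part X).
Definition rot_of X (i : 'I_n) : 'M[R]_d := submxrow (rot_part X) i.

Definition pose_manifold : set (pose_mx R d n) :=
  [set X | forall i, SO (rot_of X i)].

Definition pgo_obj X : R :=
  \sum_(e in edges D)
    2^-1 * (kappa D e *
              frob_norm (rot_of X e.1 *m meas_rot D e - rot_of X e.2) ^+ 2
          + tau D e * frob_norm (rot_of X e.1 *m meas_trans D e
                                 + tr_of X e.1 - tr_of X e.2) ^+ 2).

(* The quadratic form of Omega. *)
Definition omega_form X : R :=
  \sum_(e in edges D)
    (kappa D e * (frob_norm (rot_of X e.1) ^+ 2 + frob_norm (rot_of X e.2) ^+ 2)
     + tau D e * (frob_norm (rot_of X e.1 *m meas_trans D e + tr_of X e.1) ^+ 2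
                  + frob_norm (tr_of X e.2) ^+ 2)).

(* Blocks of Gamma = Omega + alpha I; gamma_nu i is the coupling between t_i and
   R_i. Off the diagonal all three block families vanish. *)
Definition gamma_tau (alpha : R) (i : 'I_n) : R :=
  alpha + \sum_(e in edges D | (e.1 == i) || (e.2 == i)) 2 * tau D e.

Definition gamma_rho (alpha : R) (i : 'I_n) : 'M[R]_d :=
  alpha%:M
  + (\sum_(e in edges D | (e.1 == i) || (e.2 == i)) 2 * kappa D e)%:M
  + \sum_(e in edges D | e.1 == i)
      (2 * tau D e) *: (meas_trans D e *m (meas_trans D e)^T).

Definition gamma_nu (i : 'I_n) : 'cV[R]_d :=
  \sum_(e in edges D | e.1 == i) (2 * tau D e) *: meas_trans D e.

(* In what follows M is the form matrix of the objective. *)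
Definition egrad M X : pose_mx R d n := X *m M.

(* The tangent space at X: no constraint on translations, and the rotation
   components satisfy the linearized equation of R_i^T R_i = I. *)
Definition tangent X : set (pose_mx R d n) :=
  [set H | forall i, (rot_of X i)^T *m rot_of H i
                     + (rot_of H i)^T *m rot_of X i = 0].

(* G is the orthogonal projection of the Euclidean gradient on tangent X. *)
Definition riem_grad M X G : Prop :=
  tangent X G /\ forall H, tangent X H -> frob_inner (egrad M X - G) H = 0.

Definition argmax_SO (theta Q : 'M[R]_d) : Prop :=
  SO Q /\ forall P, SO P -> \tr (P^T *m theta) <= \tr (Q^T *m theta).

Definition theta_common (alpha : R) M Y (i : 'I_n) : 'M[R]_d :=
  rot_of Y i *m (gamma_rho alpha i
                 - (gamma_tau alpha i)^-1 *: (gamma_nu i *m (gamma_nu i)^T))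
  - rot_of (egrad M Y) i.

Definition theta (alpha : R) M Y (i : 'I_n) : 'M[R]_d :=
  theta_common alpha M Y i
  + (gamma_tau alpha i)^-1 *: (tr_of (egrad M Y) i *m (gamma_nu i)^T).

(* t = - R V^T L^+, with L and V the upper blocks of M. *)
Definition tr_optimal M X : Prop :=
  exists2 Ldag : 'M[R]_n, moore_penrose (ulsubmx M) Ldag &
    tr_part X = - (rot_part X *m (ursubmx M)^T *m Ldag).

Definition step (alpha : R) M Y X : Prop :=
  forall i : 'I_n,
    argmax_SO (theta alpha M Y i) (rot_of X i) /\
    tr_of X i = tr_of Y i
      - (gamma_tau alpha i)^-1 *: (rot_of X i *m gamma_nu i)
      + (gamma_tau alpha i)^-1 *:
          (rot_of Y i *m gamma_nu i - tr_of (egrad M Y) i).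

Definition step_star (alpha : R) M Y X : Prop :=
  (forall i : 'I_n, argmax_SO (theta_common alpha M Y i) (rot_of X i)) /\
  tr_optimal M X.

Section Methods.
(* stp Y X: X is a possible result of the elementary step applied to Y. *)
Variable stp : pose_mx R d n -> pose_mx R d n -> Prop.

Definition gpm_run (N0 : nat) (Z0 : pose_mx R d n)
    (Z : nat -> pose_mx R d n) : Prop :=
  Z 0%N = Z0 /\ forall i, (i < N0)%N -> stp (Z i) (Z i.+1).

(* Vm1 is V^(-1). *)
Definition nag_extrapolation (Vm1 : pose_mx R d n)
    (V : nat -> pose_mx R d n) (s : nat -> R) (i : nat) : pose_mx R d n :=
  let Vprev := if i is j.+1 then V j else Vm1 in
  V i + ((s i - 1) / s i.+1) *: (V i - Vprev).

Definition nag_run (N0 : nat) (V0 Vm1 : pose_mx R d n) (s0 : R)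
    (V : nat -> pose_mx R d n) (s : nat -> R) : Prop :=
  [/\ V 0%N = V0, s 0%N = s0 &
      forall i, (i < N0)%N ->
        s i.+1 = (Num.sqrt (4 * s i ^+ 2 + 1) + 1) / 2 /\
        stp (nag_extrapolation Vm1 V s i) (V i.+1)].

Definition outer_update (N0 : nat) (eta delta : R)
    (X T : nat -> pose_mx R d n) (a f : nat -> R) (k : nat) : Prop :=
  exists V s,
    [/\ nag_run N0 (X k) (T k) (a k) V s,
        if pgo_obj (V N0) <= f k - delta * frob_norm (V N0 - X k) ^+ 2
        then [/\ a k.+1 = s N0, X k.+1 = V N0 & T k.+1 = V N0.-1]
        else exists2 Z, gpm_run N0 (X k) Z &
             [/\ a k.+1 = 1, X k.+1 = Z N0 & T k.+1 = Z N0] &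
        f k.+1 = (1 - eta) * f k + eta * pgo_obj (X k.+1)].

Definition outer_run (N0 : nat) (eta delta : R)
    (X : nat -> pose_mx R d n) : Prop :=
  exists (T : nat -> pose_mx R d n) (a f : nat -> R),
    [/\ a 0%N = 1, T 0%N = X 0%N, f 0%N = pgo_obj (X 0%N) &
        forall k, outer_update N0 eta delta X T a f k].

End Methods.

Definition agpm_pgo (alpha : R) M (N0 : nat) (eta delta : R)
    (X : nat -> pose_mx R d n) : Prop :=
  pose_manifold (X 0%N) /\ outer_run (step alpha M) N0 eta delta X.

Definition agpm_pgo_star (alpha : R) M (N0 : nat) (eta delta : R)
    (X : nat -> pose_mx R d n) : Prop :=
  [/\ pose_manifold (X 0%N), tr_optimal M (X 0%N) &
      outer_run (step_star alpha M) N0 eta delta X].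

End PoseGraph.

(* Main.v *)
Require Import Defs.
From HB Require Import structures.
From mathcomp Require Import all_boot all_order all_algebra.
From mathcomp Require Import boolp classical_sets functions reals.
From mathcomp Require Import topology normedtype sequences.
From mathcomp Require Import ring lra.

Set Implicit Arguments.
Unset Strict Implicit.
Unset Printing Implicit Defensive.

Import Order.TTheory GRing.Theory Num.Theory.
Import numFieldNormedType.Exports.
Local Open Scope classical_set_scope.
Local Open Scope ring_scope.

(** Throughout, gamma_form H is the quadratic form of Gamma, tr (H Gamma H^T) / 2,
    and sqn is the squared Frobenius norm.

    Majorization. The objective F is quadratic, so
    F X = F Y + <grad F(Y), X - Y> + F (X - Y) exactly. Each term of F is a
    square ||a - b||^2 while the corresponding term of omega_form is
    2 ||a||^2 + 2 ||b||^2 (up to the same factor), so F <= omega_form <= gamma_form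
    and the model F Y + <grad F(Y), X - Y> + gamma_form (X - Y) lies above F.
    It decouples over the vertices (gamma_formE); at each vertex, eliminating the
    translation leaves a function of the rotation which on SO(d) is affine, and
    the elementary step minimizes it (block_model_le0). Hence a step from a point
    Y of the manifold to X gives F X <= F Y - (gamma_form - F) (X - Y)
    (step_descent). If gamma_form - F dominates c sqn, which is surrogate_margin c,
    then F decreases by at least c sqn (X - Y). Such a c > 0 exists when Gamma - M is
    positive definite, and also when alpha > 0.

    Starred steps. At a point with optimal translations the translation gradient
    vanishes (tr_optimal_stationary), so the starred step chooses its rotations as
    the unstarred one would, and then its translations minimize F outright. It
    therefore descends at least as much; since the optimal translations are a
    linear function of the rotations, its length is controlled by the change of
    the rotations (step_star_decrease).

    The outer loop. The averages f satisfy F (X k) <= f k, and whether the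
    accelerated iterate is accepted or the safeguard is used,
    F (X k.+1) <= f k - mu sqn (X k.+1 - X k) with mu >= 0. So f is nonincreasing and
    bounded below, hence converges; F (X k.+1) is the combination
    (f k.+1 - (1 - eta) f k) / eta of consecutive averages and converges as well; and
    when mu > 0 the increments tend to zero (outer_run_obj_cvg,
    outer_run_increment_cvg0).

    Gradients. Let X be obtained by a step from any Y, on the manifold or not. The
    maximality of its rotations gives a first-order condition: testing with
    the rotations Q R, where R is the Cayley transform of a small skew matrix, shows
    that theta is orthogonal to the tangent space (argmax_SO_stationary). Therefore
    the Riemannian gradient at X is a linear function of X - Y up to normal
    directions, and sqn (grad F(X)) <= C sqn (X - Y)
    (argmax_riem_grad_bound). For N0 = 1 the point Y is an extrapolation from
    two consecutive outer iterates with coefficient at most 1, so X - Y is bounded by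
    the last two increments, which tend to zero (outer_run_single_step). *)

(** * The Frobenius inner product *)

Local Notation sqn A := (frob_inner A A).

Section Frobenius.
Variable R : realType.
Implicit Types (m p q : nat).

Lemma frob_innerE m p (A B : 'M[R]_(m, p)) :
  frob_inner A B = \sum_i \sum_j A i j * B i j.
Proof.
by apply: eq_bigr => i _; rewrite mxE; apply: eq_bigr => j _; rewrite mxE.
Qed.

Lemma frob_innerC m p (A B : 'M[R]_(m, p)) : frob_inner A B = frob_inner B A.
Proof. by rewrite /frob_inner -mxtrace_tr trmx_mul trmxK. Qed.

Lemma frob_innerDl m p (A B C : 'M[R]_(m, p)) :
  frob_inner (A + B) C = frob_inner A C + frob_inner B C.
Proof. by rewrite /frob_inner mulmxDl mxtraceD. Qed.

Lemma frob_innerZl m p a (A C : 'M[R]_(m, p)) :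
  frob_inner (a *: A) C = a * frob_inner A C.
Proof. by rewrite /frob_inner -scalemxAl mxtraceZ. Qed.

Lemma frob_innerNl m p (A C : 'M[R]_(m, p)) :
  frob_inner (- A) C = - frob_inner A C.
Proof. by rewrite /frob_inner mulNmx raddfN. Qed.

Lemma frob_innerDr m p (A B C : 'M[R]_(m, p)) :
  frob_inner C (A + B) = frob_inner C A + frob_inner C B.
Proof. by rewrite !(frob_innerC C) frob_innerDl. Qed.

Lemma frob_innerZr m p a (A C : 'M[R]_(m, p)) :
  frob_inner C (a *: A) = a * frob_inner C A.
Proof. by rewrite !(frob_innerC C) frob_innerZl. Qed.

Lemma frob_innerNr m p (A C : 'M[R]_(m, p)) :
  frob_inner C (- A) = - frob_inner C A.
Proof. by rewrite !(frob_innerC C) frob_innerNl. Qed.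

Lemma frob_inner0l m p (C : 'M[R]_(m, p)) : frob_inner 0 C = 0.
Proof. by rewrite /frob_inner mul0mx mxtrace0. Qed.

Lemma frob_inner0r m p (C : 'M[R]_(m, p)) : frob_inner C 0 = 0.
Proof. by rewrite frob_innerC frob_inner0l. Qed.

Lemma frob_inner_suml m p I (r : seq I) (P : pred I) (A : I -> 'M[R]_(m, p)) C :
  frob_inner (\sum_(i <- r | P i) A i) C = \sum_(i <- r | P i) frob_inner (A i) C.
Proof. by rewrite /frob_inner mulmx_suml raddf_sum. Qed.

Lemma frob_inner_mulr m p q (A : 'M[R]_(m, p)) (C : 'M[R]_(p, q)) B :
  frob_inner (A *m C) B = frob_inner A (B *m C^T).
Proof. by rewrite /frob_inner trmx_mul trmxK mulmxA. Qed.

Lemma frob_inner_mull m p q (A : 'M[R]_(p, q)) (C : 'M[R]_(m, p)) B :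
  frob_inner (C *m A) B = frob_inner A (C^T *m B).
Proof. by rewrite /frob_inner trmx_mul trmxK mxtrace_mulC mulmxA mxtrace_mulC mulmxA. Qed.

Definition frob_inner_linear := (frob_innerDl, frob_innerDr, frob_innerNl,
  frob_innerNr, frob_innerZl, frob_innerZr).

Lemma sqn_ge0 m p (A : 'M[R]_(m, p)) : 0 <= sqn A.
Proof.
by rewrite frob_innerE; do 2!apply: sumr_ge0 => ? _; rewrite -expr2 sqr_ge0.
Qed.

Lemma sqn_entry m p (A : 'M[R]_(m, p)) i j : A i j ^+ 2 <= sqn A.
Proof.
have h k l : 0 <= A k l * A k l by rewrite -expr2 sqr_ge0.
rewrite frob_innerE (bigD1 i) //= (bigD1 j) //= expr2 -addrA lerDl addr_ge0 //.
  by apply: sumr_ge0.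
by apply: sumr_ge0 => k _; apply: sumr_ge0.
Qed.

Lemma sqn_eq0 m p (A : 'M[R]_(m, p)) : sqn A = 0 -> A = 0.
Proof.
move=> A0; apply/matrixP => i j; rewrite mxE; apply/eqP; rewrite -sqrf_eq0.
by rewrite eq_le sqr_ge0 andbT -A0 sqn_entry.
Qed.

Lemma sqnN m p (A : 'M[R]_(m, p)) : sqn (- A) = sqn A.
Proof. by rewrite !frob_inner_linear opprK. Qed.

Lemma frob_norm_sqr m p (A : 'M[R]_(m, p)) : frob_norm A ^+ 2 = sqn A.
Proof. by rewrite /frob_norm sqr_sqrtr // sqn_ge0. Qed.

Lemma frob_inner_amgm m p (A B : 'M[R]_(m, p)) :
  2 * frob_inner A B <= sqn A + sqn B.
Proof.
have := sqn_ge0 (A - B); rewrite !frob_inner_linear (frob_innerC B A); lra.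
Qed.

Lemma sqnD_le m p (A B : 'M[R]_(m, p)) : sqn (A + B) <= 2 * sqn A + 2 * sqn B.
Proof.
have := sqn_ge0 (A - B); rewrite !frob_inner_linear (frob_innerC B A); lra.
Qed.

(** Cauchy-Schwarz for the possibly degenerate form <X S, Y>. The degenerate case
    matters: applied to the matrix of the objective, it says that the gradient
    vanishes wherever the quadratic form does. *)
Lemma frob_cauchy_schwarz_mx m p (S : 'M[R]_p) (X Y : 'M[R]_(m, p)) :
  S^T = S -> (forall Z : 'M[R]_(m, p), 0 <= frob_inner (Z *m S) Z) ->
  frob_inner (X *m S) Y ^+ 2 <=
    frob_inner (X *m S) X * frob_inner (Y *m S) Y.
Proof.
move=> symS psdS; pose b := frob_inner (X *m S) Y.
have bC : frob_inner (Y *m S) X = b by rewrite frob_inner_mulr symS frob_innerC.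
have quad u v : 0 <= u ^+ 2 * frob_inner (X *m S) X + 2 * u * v * b
                     + v ^+ 2 * frob_inner (Y *m S) Y.
  have := psdS (u *: X + v *: Y).
  rewrite mulmxDl -!scalemxAl !frob_inner_linear bC -/b; lra.
(* the minimizing combination y X - b Y, up to scale *)
rewrite -/b; have:= quad (frob_inner (Y *m S) Y) (- b).
have:= psdS Y; have := psdS X.
set x := frob_inner _ X; set y := frob_inner _ Y => x0; rewrite le_eqVlt => /orP[/eqP y0|y0 h].
  (* when y = 0, any large enough multiple of - Y forces b = 0 *)
  move=> _; have:= quad b (- (x + 1)); rewrite -/x -/y -y0 mulr0 mulr0 addr0.
  by move=> h; have := sqr_ge0 b; nra.
rewrite -subr_ge0 -(pmulr_rge0 _ y0); lra.
Qed.

Lemma frob_cauchy_schwarz m p (A B : 'M[R]_(m, p)) :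
  frob_inner A B ^+ 2 <= sqn A * sqn B.
Proof.
have := @frob_cauchy_schwarz_mx m p 1%:M A B (trmx1 _ _).
by rewrite !mulmx1; apply => Z; rewrite mulmx1 sqn_ge0.
Qed.

Lemma sqn_trmx m p (A : 'M[R]_(m, p)) : sqn A^T = sqn A.
Proof. by rewrite /frob_inner trmxK mxtrace_mulC. Qed.

Lemma sqn_mulmx m p q (A : 'M[R]_(m, p)) (B : 'M[R]_(p, q)) :
  sqn (A *m B) <= sqn A * sqn B.
Proof.
rewrite [leLHS]frob_innerE -[sqn B]sqn_trmx !frob_innerE mulr_suml.
apply: ler_sum => i _; rewrite mulr_sumr; apply: ler_sum => j _.
rewrite -expr2.
have := frob_cauchy_schwarz (row i A) (row j B^T); rewrite !frob_innerE !big_ord1.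
congr (_ ^+ 2 <= _ * _); first by rewrite mxE; apply: eq_bigr => k _; rewrite !mxE.
  by apply: eq_bigr => k _; rewrite !mxE.
by apply: eq_bigr => k _; rewrite !mxE.
Qed.

End Frobenius.

(** * Bounded maps between matrix spaces *)

Section FrobeniusBounds.
Variable R : realType.

(** The operator bound of a linear map, kept as a bare inequality because it is
    stable under the operations that assemble such maps from blocks. *)
Definition frob_bounded m p m' p' (f : 'M[R]_(m, p) -> 'M[R]_(m', p')) : Prop :=
  exists2 C, 0 <= C & forall A, sqn (f A) <= C * sqn A.

Lemma frob_boundedD m p m' p' (f g : 'M[R]_(m, p) -> 'M[R]_(m', p')) :
  frob_bounded f -> frob_bounded g -> frob_bounded (fun A => f A + g A).
Proof.
move=> [C C0 fC] [K K0 gK]; exists (2 * C + 2 * K); first lra.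
move=> A; have := sqnD_le (f A) (g A); have := fC A; have := gK A; lra.
Qed.

Lemma frob_boundedZ m p m' p' a (f : 'M[R]_(m, p) -> 'M[R]_(m', p')) :
  frob_bounded f -> frob_bounded (fun A => a *: f A).
Proof.
move=> [C C0 fC]; exists (a ^+ 2 * C); first by rewrite mulr_ge0 // sqr_ge0.
move=> A; rewrite frob_innerZl frob_innerZr mulrA -expr2 -[leRHS]mulrA.
by apply: ler_wpM2l; rewrite ?sqr_ge0.
Qed.

Lemma frob_boundedN m p m' p' (f : 'M[R]_(m, p) -> 'M[R]_(m', p')) :
  frob_bounded f -> frob_bounded (fun A => - f A).
Proof. by move=> [C C0 fC]; exists C => // A; rewrite sqnN. Qed.

Lemma frob_bounded_mulmx m p m' p' q
    (f : 'M[R]_(m, p) -> 'M[R]_(m', p')) (B : 'M[R]_(p', q)) :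
  frob_bounded f -> frob_bounded (fun A => f A *m B).
Proof.
move=> [C C0 fC]; exists (C * sqn B); first by rewrite mulr_ge0 // sqn_ge0.
move=> A; apply: le_trans (sqn_mulmx _ _) _; rewrite mulrAC ler_wpM2r ?sqn_ge0 //.
Qed.

Lemma frob_bounded_comp m p m' p' m2 p2 (f : 'M[R]_(m, p) -> 'M[R]_(m', p'))
    (g : 'M[R]_(m', p') -> 'M[R]_(m2, p2)) :
  frob_bounded f -> frob_bounded g -> frob_bounded (fun A => g (f A)).
Proof.
move=> [C C0 fC] [K K0 gK]; exists (K * C); first by rewrite mulr_ge0.
by move=> A; apply: le_trans (gK _) _; rewrite -mulrA ler_wpM2l.
Qed.

Lemma frob_bounded_id m p : frob_bounded (@id 'M[R]_(m, p)).
Proof. by exists 1 => // A; rewrite mul1r. Qed.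

Lemma frob_bounded_sum (I : eqType) (r : seq I) m p m' p'
    (f : I -> 'M[R]_(m, p) -> 'M[R]_(m', p')) :
  (forall i, frob_bounded (f i)) ->
  exists2 C, 0 <= C & forall A, \sum_(i <- r) sqn (f i A) <= C * sqn A.
Proof.
move=> fb; elim: r => [|i r [C C0 hC]].
  by exists 0 => // A; rewrite big_nil mul0r.
have [K K0 hK] := fb i; exists (K + C) => [|A]; first exact: addr_ge0.
by rewrite big_cons mulrDl lerD.
Qed.

(** With B the inverse of S, sqn A = <A S, A B>; Cauchy-Schwarz for the form of S
    bounds its square by <A S, A> <A, A B>, and <A, A B> <= K sqn A. This gives a
    coercivity constant without compactness of the unit sphere or eigenvalues. *)
Lemma posdef_coercive m p (S : 'M[R]_p) : posdef S ->
  exists2 c, 0 < c &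
    forall A : 'M[R]_(m, p), c * sqn A <= frob_inner (A *m S) A.
Proof.
case=> symS posS.
have rowE (A : 'M[R]_(m, p)) i :
    (A *m S *m A^T) i i = (((row i A)^T)^T *m S *m (row i A)^T) 0 0.
  rewrite trmxK !mxE; apply: eq_bigr => j _; rewrite !mxE; congr (_ * _).
  by apply: eq_bigr => k _; rewrite !mxE.
have psdS (A : 'M[R]_(m, p)) : 0 <= frob_inner (A *m S) A.
  apply: sumr_ge0 => i _; rewrite rowE.
  have [->|/posS/ltW//] := eqVneq (row i A)^T 0.
  by rewrite mulmx0 mxE.
have Su : S \in unitmx.
  rewrite -row_free_unit -kermx_eq0; apply/eqP/row_matrixP => i.
  rewrite row0; apply/eqP; apply: contraT => ki0.
  have : (row i (kermx S))^T != 0.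
    by apply: contra ki0 => /eqP k0; rewrite -[row _ _]trmxK k0 trmx0.
  move=> /posS; rewrite trmxK -row_mul mulmx_ker row0 mul0mx mxE ltxx //.
pose B := invmx S; pose K := (1 + sqn B) / 2.
have K0 : 0 < K by rewrite /K; have := sqn_ge0 B; lra.
exists K^-1; first by rewrite invr_gt0.
move=> A; rewrite ler_pdivrMl //.
have symB : B^T = B by rewrite /B trmx_inv symS.
have := frob_cauchy_schwarz_mx A (A *m B) symS psdS.
rewrite frob_inner_mulr symS -!mulmxA mulVmx // mulmx1 -/B.
have := frob_inner_amgm A (A *m B); have := sqn_mulmx A B.
have := psdS A; have := sqn_ge0 A.
set a := sqn A; set q := frob_inner _ A; set b := frob_inner A _.
move=> a0 q0 hAB hb.
have bK : b <= K * a by rewrite /K; lra.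
move=> h; have {}h : a ^+ 2 <= q * (K * a) by apply: le_trans h _; rewrite ler_wpM2l.
move: a0; rewrite le_eqVlt => /orP[/eqP <-|a0]; first by rewrite mulr_ge0 // ltW.
by rewrite -(ler_pM2r a0) -expr2 (mulrC K) -mulrA.
Qed.

End FrobeniusBounds.

(** * Pose matrices and their blocks *)

Section PoseBlocks.
Variables (R : realType) (d n : nat).
Implicit Types (X Y : pose_mx R d n).

Lemma tr_ofD X Y i : tr_of (X + Y) i = tr_of X i + tr_of Y i.
Proof. by apply/matrixP => k l; rewrite !mxE. Qed.
Lemma tr_ofN X i : tr_of (- X) i = - tr_of X i.
Proof. by apply/matrixP => k l; rewrite !mxE. Qed.
Lemma tr_ofZ a X i : tr_of (a *: X) i = a *: tr_of X i.
Proof. by apply/matrixP => k l; rewrite !mxE. Qed.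
Lemma rot_ofD X Y i : rot_of (X + Y) i = rot_of X i + rot_of Y i.
Proof. by apply/matrixP => k l; rewrite !mxE. Qed.
Lemma rot_ofN X i : rot_of (- X) i = - rot_of X i.
Proof. by apply/matrixP => k l; rewrite !mxE. Qed.
Lemma rot_ofZ a X i : rot_of (a *: X) i = a *: rot_of X i.
Proof. by apply/matrixP => k l; rewrite !mxE. Qed.

Definition pose_blockE := (tr_ofD, tr_ofN, tr_ofZ, rot_ofD, rot_ofN, rot_ofZ).

Lemma frob_inner_parts X Y : frob_inner X Y =
  frob_inner (tr_part X) (tr_part Y) + frob_inner (rot_part X) (rot_part Y).
Proof.
by rewrite -{1}[X]hsubmxK -{1}[Y]hsubmxK /frob_inner tr_row_mx mul_row_col mxtraceD.
Qed.

Lemma frob_inner_tr_part X Y :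
  frob_inner (tr_part X) (tr_part Y) = \sum_i frob_inner (tr_of X i) (tr_of Y i).
Proof.
rewrite frob_innerE exchange_big; apply: eq_bigr => i _ /=.
by rewrite frob_innerE; apply: eq_bigr => k _; rewrite big_ord1 !mxE.
Qed.

Lemma frob_inner_rot_part X Y :
  frob_inner (rot_part X) (rot_part Y) = \sum_i frob_inner (rot_of X i) (rot_of Y i).
Proof.
rewrite /rot_of -{1}[rot_part X]submxrowK -{1}[rot_part Y]submxrowK.
rewrite /frob_inner tr_mxrow mul_mxrow_mxcol raddf_sum.
by apply: eq_bigr.
Qed.

Lemma frob_inner_blocks X Y : frob_inner X Y =
  \sum_i (frob_inner (tr_of X i) (tr_of Y i) + frob_inner (rot_of X i) (rot_of Y i)).
Proof. by rewrite frob_inner_parts frob_inner_tr_part frob_inner_rot_part big_split. Qed.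

Lemma sqn_block_le X i : sqn (tr_of X i) + sqn (rot_of X i) <= sqn X.
Proof.
rewrite [leRHS]frob_inner_blocks (bigD1 i) //= lerDl; apply: sumr_ge0 => j _.
by rewrite addr_ge0 // sqn_ge0.
Qed.

Lemma frob_bounded_tr_of i : frob_bounded (fun X => tr_of X i).
Proof.
exists 1 => // X; rewrite mul1r; apply: le_trans (sqn_block_le X i).
by rewrite lerDl sqn_ge0.
Qed.

Lemma frob_bounded_rot_of i : frob_bounded (fun X => rot_of X i).
Proof.
exists 1 => // X; rewrite mul1r; apply: le_trans (sqn_block_le X i).
by rewrite lerDr sqn_ge0.
Qed.

End PoseBlocks.

(** * First-order conditions on rotations *)

Section Rotations.
Variables (R : realType) (d : nat).
Implicit Types (P Q S A : 'M[R]_d).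

Lemma SO_trK Q : SO Q -> Q^T *m Q = 1%:M.
Proof. by case=> QQ _; apply: mulmx1C. Qed.

Lemma SO_mulmx P Q : SO P -> SO Q -> SO (P *m Q).
Proof.
move=> [PP detP] [QQ detQ]; split; last by rewrite det_mulmx detP detQ mulr1.
by rewrite trmx_mul -mulmxA (mulmxA Q) QQ mul1mx.
Qed.

Lemma SO_sqn_mulr m Q (A : 'M[R]_(m, d)) : SO Q -> sqn (A *m Q) = sqn A.
Proof. by case=> QQ _; rewrite frob_inner_mulr -mulmxA QQ mulmx1. Qed.

Lemma frob_inner_skew m S (A : 'M[R]_(m, d)) :
  S^T = - S -> frob_inner (A *m S) A = 0.
Proof.
move=> skS; have : frob_inner (A *m S) A = - frob_inner (A *m S) A.
  by rewrite {1}frob_inner_mulr skS mulmxN frob_innerNr frob_innerC.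
lra.
Qed.

(** The Cayley transform Q = (1 - S)^-1 (1 + S). The equation is (1 - S) Q = 1 + S
    rearranged: iterating it yields the expansion of Q in S with a remainder that is
    bounded because Q is orthogonal. The determinant is 1 since 1 - S is the transpose
    of 1 + S. *)
Lemma cayley_SO S : S^T = - S -> exists2 Q, SO Q & Q = 1%:M + S *m (Q + 1%:M).
Proof.
move=> skS; pose U := 1%:M - S; pose V := 1%:M + S.
have UT : U^T = V by rewrite /U /V linearB /= trmx1 skS opprK.
have VT : V^T = U by rewrite -UT trmxK.
have Uu : U \in unitmx.
  rewrite -row_free_unit -kermx_eq0; apply/eqP/sqn_eq0.
  rewrite -[RHS](frob_inner_skew (kermx U) skS); congr frob_inner.
  by apply/eqP; rewrite -subr_eq0 -{1}[kermx U]mulmx1 -mulmxBr mulmx_ker.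
have Vu : V \in unitmx by rewrite -UT unitmx_tr.
pose Q := invmx U *m V.
have UV : V *m U = U *m V.
  rewrite /U mulmxBr mulmx1 [RHS]mulmxBl mul1mx /V.
  by rewrite mulmxDl mul1mx mulmxDr mulmx1.
have defQ : U *m Q = V by rewrite mulmxA mulmxV // mul1mx.
exists Q; first split.
- rewrite trmx_mul trmx_inv UT VT -mulmxA (mulmxA V) UV -(mulmxA U) mulmxV //.
  by rewrite mulmx1 mulVmx.
- by rewrite det_mulmx det_inv -[\det V]det_tr VT mulVr.
have -> : Q = V + S *m Q by rewrite -defQ mulmxBl mul1mx subrK.
by rewrite -[in RHS]defQ mulmxBl mul1mx subrK mulmxDr mulmx1 /V addrAC addrA.
Qed.

(** Compare Q with Q P, where P = 1 + 2 t S + t^2 S^2 (P + 1) is the Cayley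
    transform of t S. Maximality of Q gives 2 t b <= K t^2 for all t, where
    b = <Q S, A>, which forces b = 0. *)
Lemma argmax_SO_stationary A Q S :
  argmax_SO A Q -> S^T = - S -> frob_inner (Q *m S) A = 0.
Proof.
move=> [SOQ maxQ] skS; pose B := Q^T *m A.
rewrite frob_inner_mull -/B.
pose K := 4 * d%:R + sqn (S^T *m S^T *m B).
have bound t : 2 * t * frob_inner S B <= t ^+ 2 * K.
  have sktS : (t *: S)^T = - (t *: S) by rewrite linearZ /= skS scalerN.
  have [P SOP defP] := cayley_SO sktS.
  have := maxQ _ (SO_mulmx SOQ SOP).
  have innE C : \tr (C^T *m A) = frob_inner C A.
    by rewrite -mxtrace_tr trmx_mul trmxK mxtrace_mulC.
  rewrite !innE frob_inner_mull -/B.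
  have -> : frob_inner Q A = frob_inner 1%:M B.
    by rewrite -frob_inner_mull mulmx1.
  have {1}-> : P = 1%:M + (2 * t) *: S + t ^+ 2 *: (S *m S *m (P + 1%:M)).
    have eqP1 : P + 1%:M = 2 *: 1%:M + t *: S *m (P + 1%:M).
      by rewrite {1}defP addrAC -addrA scaler_nat mulr2n addrA.
    rewrite {1}defP {1}eqP1 mulmxDr -scalemxAr mulmx1 scalerA addrA.
    by rewrite -!scalemxAl -scalemxAr !mulmxA scalerA -expr2.
  rewrite !frob_innerDl !frob_innerZl -mulmxA !frob_inner_mull mulmxA.
  have := frob_inner_amgm (- (P + 1%:M)) (S^T *m S^T *m B).
  rewrite frob_innerNl sqnN.
  have := sqnD_le P 1%:M.
  have -> : sqn P = d%:R by rewrite /frob_inner (SOP.1) mxtrace1.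
  have -> : sqn (1%:M : 'M[R]_d) = d%:R.
    by rewrite /frob_inner trmx1 mulmx1 mxtrace1.
  set x := sqn (P + _); set w := sqn (S^T *m _ *m _); set z := frob_inner _ (_ *m B).
  move=> hx hz h.
  have : t ^+ 2 * (- z) <= t ^+ 2 * K.
    apply: ler_wpM2l; first exact: sqr_ge0.
    rewrite /K -/w; have : (0 : R) <= d%:R by []; have : 0 <= w by rewrite /w sqn_ge0.
    have := sqn_ge0 (P + 1%:M); rewrite -/x; lra.
  lra.
have K0 : 0 <= K.
  have : (0 : R) <= d%:R by [].
  by have := sqn_ge0 (S^T *m S^T *m B); rewrite /K; lra.
set b := frob_inner S B in bound *.
(* with b = t (K + 1) the bound reads t^2 (K + 2) <= 0 *)
have := bound (b / (K + 1)).
have K1 : K + 1 != 0 by rewrite gt_eqF ?ltr_wpDl.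
set t := b / (K + 1); have -> : b = t * (K + 1) by rewrite /t divfK.
move=> h; have : t ^+ 2 * (K + 2) <= 0 by lra.
have t2 := sqr_ge0 t; rewrite pmulr_lle0; last by lra.
move=> t20; have /eqP : t ^+ 2 = 0 by lra.
by rewrite sqrf_eq0 => /eqP ->; rewrite mul0r.
Qed.

End Rotations.

(** * The objective and its separable majorant *)

Section QuadraticForms.
Variables (R : realType) (d n : nat) (D : pgo_data R d n).
Implicit Types (X Y H : pose_mx R d n).

Lemma pgo_obj_ge0 X : 0 <= pgo_obj D X.
Proof.
apply: sumr_ge0 => e eE; apply: mulr_ge0; first by rewrite invr_ge0.
apply: addr_ge0; rewrite mulr_ge0 ?sqr_ge0 //.
  exact: kappa_ge0.
by rewrite ltW // tau_gt0.
Qed.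

Lemma pgo_obj_le_omega X : pgo_obj D X <= omega_form D X.
Proof.
apply: ler_sum => e eE; rewrite !frob_norm_sqr.
have k0 := kappa_ge0 eE; have t0 := tau_gt0 eE.
have hrot := sqnD_le (rot_of X e.1 *m meas_rot D e) (- rot_of X e.2).
have htr := sqnD_le (rot_of X e.1 *m meas_trans D e + tr_of X e.1) (- tr_of X e.2).
rewrite !sqnN in hrot htr; rewrite SO_sqn_mulr in hrot; last exact: meas_rotP.
rewrite mulrDr lerD // mulrCA.
  by apply: ler_wpM2l => //; lra.
by apply: ler_wpM2l; [exact: ltW|lra].
Qed.

(** Since there are no loops, an edge meets exactly two vertices. *)
Lemma sum_incident (f : 'I_n * 'I_n -> 'I_n -> R) :
  \sum_i \sum_(e in edges D | (e.1 == i) || (e.2 == i)) f e i =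
  \sum_(e in edges D) (f e e.1 + f e e.2).
Proof.
rewrite (exchange_big_dep (fun e => e \in edges D)) /=; last by move=> i e _ /andP[].
apply: eq_bigr => e eE; rewrite (bigD1 e.1) ?eE ?eqxx //=; congr (_ + _).
rewrite (big_pred1 e.2) => [|i]; first by [].
have := edges_noloop eE; rewrite ![_ == i]eq_sym => /negPf hne.
by case: (eqVneq i e.1) => [->|_]; rewrite ?andbT.
Qed.

Lemma sum_outgoing (f : 'I_n * 'I_n -> 'I_n -> R) :
  \sum_i \sum_(e in edges D | e.1 == i) f e i = \sum_(e in edges D) f e e.1.
Proof.
rewrite (exchange_big_dep (fun e => e \in edges D)) /=; last by move=> i e _ /andP[].
by apply: eq_bigr => e eE; rewrite (big_pred1 e.1) // => i; rewrite eE eq_sym.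
Qed.

Variable alpha : R.

Definition gamma_form X : R := omega_form D X + alpha / 2 * sqn X.

Lemma gamma_rho_sym i : (gamma_rho D alpha i)^T = gamma_rho D alpha i.
Proof.
rewrite /gamma_rho !linearD /= !tr_scalar_mx linear_sum /=; congr (_ + _).
by apply: eq_bigr => e _; rewrite linearZ /= trmx_mul trmxK.
Qed.

(** The form of Gamma is separable over the vertices: sums over edges are regrouped
    by endpoint, both endpoints for the diagonal terms and the tail alone for the
    terms that involve the measured translation. *)
Lemma gamma_formE X : gamma_form X =
  \sum_i 2^-1 * (gamma_tau D alpha i * sqn (tr_of X i)
     + 2 * frob_inner (rot_of X i *m gamma_nu D i) (tr_of X i)
     + frob_inner (rot_of X i *m gamma_rho D alpha i) (rot_of X i)).
Proof.
pose inc e i := tau D e * sqn (tr_of X i) + kappa D e * sqn (rot_of X i).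
pose out e i := tau D e * (2 * frob_inner (rot_of X i *m meas_trans D e) (tr_of X i)
   + sqn (rot_of X i *m meas_trans D e)).
transitivity (\sum_i (alpha / 2 * (sqn (tr_of X i) + sqn (rot_of X i))
  + \sum_(e in edges D | (e.1 == i) || (e.2 == i)) inc e i
  + \sum_(e in edges D | e.1 == i) out e i)).
  rewrite !big_split /= sum_incident sum_outgoing -mulr_sumr -frob_inner_blocks.
  rewrite -addrA addrC -big_split /=; congr (_ + _).
  apply: eq_bigr => e _; rewrite !frob_norm_sqr /inc /out.
  rewrite !frob_inner_linear (frob_innerC (tr_of X e.1)); ring.
apply: eq_bigr => i _; rewrite /gamma_tau /gamma_nu /gamma_rho.
rewrite !mulmxDr !mul_mx_scalar !frob_innerDl !frob_innerZl !mulmx_sumr !frob_inner_suml.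
have -> : \sum_(e in edges D | (e.1 == i) || (e.2 == i)) inc e i = 2^-1 *
    ((\sum_(e in edges D | (e.1 == i) || (e.2 == i)) 2 * tau D e) * sqn (tr_of X i)
     + (\sum_(e in edges D | (e.1 == i) || (e.2 == i)) 2 * kappa D e)
       * sqn (rot_of X i)).
  rewrite !mulr_suml -big_split mulr_sumr; apply: eq_bigr => e _ /=.
  by rewrite /inc; field.
have -> : \sum_(e in edges D | e.1 == i) out e i = 2^-1 *
  (2 * \sum_(e in edges D | e.1 == i)
   frob_inner (rot_of X i *m ((2 * tau D e) *: meas_trans D e)) (tr_of X i)
   + \sum_(e in edges D | e.1 == i) frob_inner (rot_of X i *m
     ((2 * tau D e) *: (meas_trans D e *m (meas_trans D e)^T))) (rot_of X i)).
  rewrite mulr_sumr -big_split mulr_sumr; apply: eq_bigr => e _ /=.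
  rewrite -!scalemxAr !frob_innerZl mulmxA (frob_inner_mulr _ _^T) trmxK /out.
  by field.
by field.
Qed.

(** A connected graph on at least two vertices has no isolated vertex. *)
Lemma gamma_tau_gt0 i : (2 <= n)%N -> 0 <= alpha -> 0 < gamma_tau D alpha i.
Proof.
move=> n2 a0; rewrite /gamma_tau ltr_wpDl //.
have [j ji] : exists j : 'I_n, j != i.
  have n0 : (0 < n)%N by apply: leq_trans n2.
  have [i0|i0] := eqVneq i (Ordinal n0); first exists (Ordinal n2).
    by rewrite i0.
  by exists (Ordinal n0); rewrite eq_sym.
have [e eE ei] : exists2 e, e \in edges D & (e.1 == i) || (e.2 == i).
  have /connectP[[|k p] /=] := edges_connected D i j.
    by move=> _ ij; rewrite ij eqxx in ji.
  by move=> /andP[/orP[ik|ki] _] _; [exists (i, k)|exists (k, i)];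
    rewrite //= eqxx ?orbT.
rewrite (bigD1 e) ?eE //= ltr_pwDl ?mulr_gt0 ?tau_gt0 //.
by apply: sumr_ge0 => f /andP[/andP[fE _] _]; rewrite mulr_ge0 // ltW // tau_gt0.
Qed.

End QuadraticForms.

(** * Descent of the elementary steps *)

Section BlockModel.
Variables (R : realType) (d : nat).

(** The model at one vertex, relative to its value at the current point: Q and P
    are the old and new rotations, h the displacement of the translation, g and G the
    gradient blocks. With B = rho - nu nu^T / T, completing the square in h leaves
    - sqn g / (2 T) plus a function of P that is affine on SO(d), because <P B, P> is
    the trace of B for every rotation P. That affine function is - <P, theta> up
    to a constant, so P does at least as well as Q. *)
Lemma block_model_le0 (T : R) (nu g h : 'cV[R]_d) (rho Q P G : 'M[R]_d) :
    0 < T -> rho^T = rho -> SO Q ->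
    argmax_SO (Q *m (rho - T^-1 *: (nu *m nu^T)) - G + T^-1 *: (g *m nu^T)) P ->
    h = - (T^-1 *: ((P - Q) *m nu + g)) ->
  frob_inner g h + frob_inner G (P - Q)
  + 2^-1 * (T * sqn h + 2 * frob_inner ((P - Q) *m nu) h
            + frob_inner ((P - Q) *m rho) (P - Q)) <= 0.
Proof.
move=> T0 symrho SOQ [SOP maxP] defh.
have symB : (rho - T^-1 *: (nu *m nu^T))^T = rho - T^-1 *: (nu *m nu^T).
  by rewrite linearB linearZ /= trmx_mul trmxK symrho.
have := maxP _ SOQ.
have innE (U V : 'M[R]_d) : \tr (U^T *m V) = frob_inner V U.
  by rewrite mxtrace_mulC.
rewrite !innE.
set B := rho - _ in symB *; set H := P - Q in defh *.
have -> : frob_inner (H *m rho) H = frob_inner (H *m B) H + T^-1 * sqn (H *m nu).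
  rewrite mulmxBr -scalemxAr frob_innerDl frob_innerNl frob_innerZl mulmxA.
  by rewrite (frob_inner_mulr _ nu^T) trmxK subrK.
move: B symB {maxP} => B symB.
have trB (U : 'M[R]_d) : SO U -> frob_inner (U *m B) U = frob_inner B 1%:M.
  by move=> /SO_trK UU; rewrite frob_inner_mull UU.
have swapB : frob_inner (P *m B) Q = frob_inner (Q *m B) P.
  by rewrite frob_inner_mulr symB frob_innerC.
have -> : frob_inner (H *m B) H =
    2 * frob_inner B 1%:M - 2 * frob_inner (Q *m B) P.
  rewrite /H mulmxBl !frob_inner_linear !trB // swapB; ring.
rewrite !frob_innerDl !frob_innerNl !frob_innerZl trB //.
rewrite !(frob_inner_mulr g) trmxK.
have -> : frob_inner G H = frob_inner G P - frob_inner G Q.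
  by rewrite /H frob_innerDr frob_innerNr.
have -> : frob_inner g h = - (T^-1 * (frob_inner g (H *m nu) + sqn g)).
  by rewrite defh frob_innerNr frob_innerZr frob_innerDr.
have -> : frob_inner (H *m nu) h =
    - (T^-1 * (sqn (H *m nu) + frob_inner g (H *m nu))).
  by rewrite defh frob_innerNr frob_innerZr frob_innerDr (frob_innerC _ g).
have -> : T * sqn h =
    T^-1 * (sqn (H *m nu) + 2 * frob_inner g (H *m nu) + sqn g).
  rewrite defh sqnN frob_innerZl frob_innerZr mulrA mulfV ?gt_eqF // mul1r.
  by rewrite frob_innerDl !frob_innerDr (frob_innerC _ g); ring.
have -> : frob_inner g (H *m nu) = frob_inner g (P *m nu) - frob_inner g (Q *m nu).
  by rewrite /H mulmxBl frob_innerDr frob_innerNr.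
have : 0 <= T^-1 * sqn g by rewrite mulr_ge0 ?sqn_ge0 // invr_ge0 ltW.
lra.
Qed.

End BlockModel.

Section MoorePenrose.
Variable R : realType.

(** Makes the optimal translations one and the same linear function of the
    rotations at all iterates. *)
Lemma moore_penrose_uniq m p (A : 'M[R]_(m, p)) B C :
  moore_penrose A B -> moore_penrose A C -> B = C.
Proof.
move=> [ABA BAB ABs BAs] [ACA CAC ACs CAs].
have eqAB : A *m B = A *m C.
  have e : A *m B = (A *m C) *m (A *m B) by rewrite mulmxA ACA.
  by rewrite -ABs e trmx_mul ABs ACs mulmxA ABA.
have eqBA : B *m A = C *m A.
  have e : B *m A = (B *m A) *m (C *m A) by rewrite -mulmxA (mulmxA A) ACA.
  by rewrite -BAs e trmx_mul BAs CAs -mulmxA (mulmxA A) ABA.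
by rewrite -BAB eqBA -mulmxA eqAB mulmxA.
Qed.

End MoorePenrose.

Section ElementarySteps.
Variables (R : realType) (d n : nat) (D : pgo_data R d n).
Variable M : 'M[R]_(pose_dim d n).
Hypothesis hM : form_matrix (pgo_obj D) M.
Variable alpha : R.
Hypothesis halpha : 0 <= alpha.
Hypothesis hn : (2 <= n)%N.
Implicit Types (X Y H G : pose_mx R d n).

Lemma rot_partB X Y : rot_part (X - Y) = rot_part X - rot_part Y.
Proof. by rewrite /rot_part linearB. Qed.

Lemma tr_partB X Y : tr_part (X - Y) = tr_part X - tr_part Y.
Proof. by rewrite /tr_part linearB. Qed.

Lemma pgo_objE X : pgo_obj D X = 2^-1 * frob_inner (egrad M X) X.
Proof. exact: hM.2. Qed.

Lemma egradD X Y : egrad M (X + Y) = egrad M X + egrad M Y.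
Proof. exact: mulmxDl. Qed.

Lemma egradN X : egrad M (- X) = - egrad M X.
Proof. exact: mulNmx. Qed.

Lemma egradZ a X : egrad M (a *: X) = a *: egrad M X.
Proof. by rewrite /egrad scalemxAl. Qed.

Lemma frob_bounded_egrad : frob_bounded (egrad M : pose_mx R d n -> _).
Proof. exact: frob_bounded_mulmx (frob_bounded_id _ _ _). Qed.

Lemma pgo_obj_taylor X Y :
  pgo_obj D X = pgo_obj D Y + frob_inner (egrad M Y) (X - Y) + pgo_obj D (X - Y).
Proof.
have symE : frob_inner (egrad M X) Y = frob_inner (egrad M Y) X.
  by rewrite frob_inner_mulr hM.1 frob_innerC.
rewrite !pgo_objE egradD egradN !frob_innerDl !frob_innerDr !frob_innerNl !frob_innerNr symE.
by field.
Qed.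

(** Quantifies Gamma - M >= 2 c I. It is phrased with quadratic forms because the
    block formulas for Gamma are used only through gamma_formE. *)
Definition surrogate_margin c :=
  forall H, c * sqn H <= gamma_form D alpha H - pgo_obj D H.

Lemma surrogate_margin_alpha : surrogate_margin (alpha / 2).
Proof. by move=> H; have := pgo_obj_le_omega D H; rewrite /gamma_form; lra. Qed.

Lemma surrogate_margin_posdef Omega :
  form_matrix (omega_form D) Omega -> posdef (Omega + alpha%:M - M) ->
  exists2 c, 0 < c & surrogate_margin c.
Proof.
move=> hO /(posdef_coercive d) [c c0 hc]; exists (c / 2); first by rewrite divr_gt0.
move=> H; have := hc H; rewrite mulmxBr mulmxDr mul_mx_scalar.
rewrite frob_innerDl frob_innerNl frob_innerDl frob_innerZl.
by rewrite pgo_objE /gamma_form hO.2 -/(frob_inner (H *m Omega) H) /egrad; lra.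
Qed.

Lemma step_descent Y X : pose_manifold Y -> step D alpha M Y X ->
  pgo_obj D X <= pgo_obj D Y + pgo_obj D (X - Y) - gamma_form D alpha (X - Y).
Proof.
move=> SOY stepX; rewrite (pgo_obj_taylor X Y).
suff : frob_inner (egrad M Y) (X - Y) + gamma_form D alpha (X - Y) <= 0 by lra.
rewrite frob_inner_blocks gamma_formE -big_split /=.
apply: sumr_le0 => i _; have [maxi tri] := stepX i.
rewrite !pose_blockE; apply: block_model_le0.
- exact: gamma_tau_gt0.
- exact: gamma_rho_sym.
- exact: SOY.
- by move: maxi; rewrite /theta /theta_common.
rewrite tri mulmxBl; set u := _ *m _; set v := _ *m _; set w := tr_of _ _.
by apply/matrixP => k l; rewrite !mxE; ring.
Qed.

Definition tr_stationary X := forall i, tr_of (egrad M X) i = 0.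

(** The residual e = R V^T (1 - L^+ L) must be shown to vanish. With K = 1 - L^+ L,
    the form of M vanishes at [e K, 0] because L K = 0; M being positive
    semidefinite, [e K, 0] M = 0, that is e K V = 0, and sqn e = <e K V, R> = 0. *)
Lemma tr_optimal_stationary X : tr_optimal M X -> tr_stationary X.
Proof.
move=> [P [LPL PLP LPs PLs] defX] i.
rewrite /tr_of; suff -> : tr_part (egrad M X) = 0 by rewrite linear0.
pose L := ulsubmx M; pose V := ursubmx M; pose r := rot_part X.
have symM := hM.1.
have symL : L^T = L by rewrite /L -[in LHS]symM trmx_ulsub trmxK.
have VT : dlsubmx M = V^T by rewrite /V -[in RHS]symM -trmx_dlsub trmxK.
pose K := 1%:M - P *m L.
have KT : K^T = K by rewrite /K linearB /= trmx1 PLs.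
have LK : L *m K = 0 by rewrite mulmxBr mulmx1 mulmxA LPL subrr.
have KL : K *m L = 0 by rewrite -KT -symL -trmx_mul LK trmx0.
have gradE Y : tr_part (egrad M Y) = tr_part Y *m L + rot_part Y *m V^T.
  rewrite /tr_part /egrad -{1}[Y]hsubmxK -{1}[M]submxK mul_row_block row_mxKl VT //.
pose e := r *m V^T *m K.
have -> : tr_part (egrad M X) = e.
  by rewrite gradE defX mulNmx /e mulmxBr mulmx1 addrC -!mulmxA.
pose Z : pose_mx R d n := row_mx (e *m K) 0.
have ZM : egrad M Z = row_mx 0 (e *m K *m V).
  by rewrite /egrad -{1}[M]submxK mul_row_block !mul0mx !addr0 -mulmxA KL mulmx0.
have psdM Y : 0 <= frob_inner (Y *m M) Y.
  have := pgo_obj_ge0 D Y; rewrite pgo_objE pmulr_rge0 ?invr_gt0 //.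
have Z0 : e *m K *m V = 0.
  apply: sqn_eq0; have := frob_cauchy_schwarz_mx Z (egrad M Z) symM psdM.
  have -> : frob_inner (Z *m M) Z = 0.
    rewrite -/(egrad M Z) ZM frob_inner_parts /tr_part /rot_part !row_mxKl !row_mxKr.
    by rewrite frob_inner0l frob_inner0r addr0.
  rewrite mul0r -/(egrad M Z) ZM frob_inner_parts /tr_part /rot_part !row_mxKl !row_mxKr.
  rewrite frob_inner0l add0r => h; apply/eqP; rewrite -sqrf_eq0 eq_le h sqr_ge0 //.
apply: sqn_eq0.
rewrite {2}/e frob_innerC frob_inner_mulr frob_inner_mulr.
by rewrite KT trmxK Z0 frob_inner0r.
Qed.

Lemma tr_stationary_extrapolation a X Y :
  tr_stationary X -> tr_stationary Y -> tr_stationary (X + a *: (X - Y)).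
Proof.
move=> hX hY i; rewrite egradD egradZ egradD egradN !pose_blockE hX hY.
by rewrite oppr0 addr0 scaler0 addr0.
Qed.

(** F is convex in the translations, so a stationary choice of them is optimal. *)
Lemma tr_stationary_obj_le X X' :
  tr_stationary X -> rot_part X = rot_part X' -> pgo_obj D X <= pgo_obj D X'.
Proof.
move=> stX eqr; rewrite [leRHS](pgo_obj_taylor X' X).
have -> : frob_inner (egrad M X) (X' - X) = 0.
  rewrite frob_inner_parts frob_inner_tr_part big1 => [|i _].
    by rewrite rot_partB eqr subrr frob_inner0r addr0.
  by rewrite stX frob_inner0l.
by rewrite addr0 lerDl pgo_obj_ge0.
Qed.

Lemma theta_tr_stationary Y i : tr_stationary Y ->
  theta D alpha M Y i = theta_common D alpha M Y i.
Proof. by move=> stY; rewrite /theta stY mul0mx scaler0 addr0. Qed.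

(** Where the translation gradient vanishes, both kinds of steps have the same
    admissible rotations; this unstarred step serves to bound F at the result of the
    starred one. *)
Lemma step_star_companion Y X : tr_stationary Y -> step_star D alpha M Y X ->
  exists2 X', step D alpha M Y X' & rot_part X' = rot_part X.
Proof.
move=> stY [maxX _].
pose t i := tr_of Y i
      - (gamma_tau D alpha i)^-1 *: (rot_of X i *m gamma_nu D i)
      + (gamma_tau D alpha i)^-1 *:
          (rot_of Y i *m gamma_nu D i - tr_of (egrad M Y) i).
pose X' : pose_mx R d n := row_mx (\matrix_(k, i) t i k 0) (rot_part X).
have rotX' : rot_part X' = rot_part X by rewrite /rot_part row_mxKr.
exists X' => // i; rewrite theta_tr_stationary // /rot_of rotX' -/(rot_of X i).
split=> //; rewrite -/(t i) /tr_of /tr_part row_mxKl.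
by apply/matrixP => k l; rewrite !mxE (ord1 l).
Qed.

Lemma step_decrease c Y X : pose_manifold Y -> surrogate_margin c ->
  step D alpha M Y X -> pgo_obj D X <= pgo_obj D Y - c * sqn (X - Y).
Proof. by move=> SOY mc /(step_descent SOY); have := mc (X - Y); lra. Qed.

(** The decrease of the companion step controls the change of the rotations, and
    the translations follow linearly. The factor k comes from that linear map; it
    does not depend on c. *)
Lemma step_star_decrease Ldag : moore_penrose (ulsubmx M) Ldag ->
  exists2 k, 0 < k & forall c Y X, 0 <= c -> surrogate_margin c ->
    pose_manifold Y -> tr_optimal M Y -> step_star D alpha M Y X ->
    pgo_obj D X <= pgo_obj D Y - k * c * sqn (X - Y).
Proof.
move=> mpL; pose B := (ursubmx M)^T *m Ldag.
have trE X : tr_optimal M X -> tr_part X = - (rot_part X *m B).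
  by move=> [P mpP ->]; rewrite (moore_penrose_uniq mpP mpL) mulmxA.
have K0 : 0 < sqn B + 1 by rewrite ltr_wpDl ?sqn_ge0.
exists (sqn B + 1)^-1; first by rewrite invr_gt0.
move=> c Y X c0 mc SOY optY stpX; have [maxX optX] := stpX.
have stY := tr_optimal_stationary optY.
have [X' stpX' rotX'] := step_star_companion stY stpX.
have := tr_stationary_obj_le (tr_optimal_stationary optX) (esym rotX').
have := step_decrease SOY mc stpX'.
have rot_le : sqn (rot_part (X - Y)) <= sqn (X' - Y).
  by rewrite rot_partB -rotX' -rot_partB (frob_inner_parts (X' - Y)) lerDr sqn_ge0.
have all_le : sqn (X - Y) <= (sqn B + 1) * sqn (rot_part (X - Y)).
  rewrite frob_inner_parts.
  have -> : tr_part (X - Y) = - (rot_part (X - Y) *m B).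
    by rewrite tr_partB (trE _ optX) (trE _ optY) rot_partB mulmxBl opprB opprK addrC.
  rewrite sqnN mulrDl mul1r; apply: lerD => //.
  by rewrite mulrC; exact: sqn_mulmx.
move=> h1 h2; apply: le_trans h2 _; apply: le_trans h1 _.
rewrite lerD2l lerN2 -[_ * c]mulrC -mulrA ler_wpM2l // ler_pdivrMl //.
apply: le_trans all_le _; apply: ler_wpM2l rot_le; exact: ltW.
Qed.

Lemma step_pose_manifold Y X : step D alpha M Y X -> pose_manifold X.
Proof. by move=> stp i; have [[]] := stp i. Qed.

Lemma step_star_pose_manifold Y X : step_star D alpha M Y X -> pose_manifold X.
Proof. by move=> [stp _] i; have [] := stp i. Qed.

(** * Steps and Riemannian gradients *)

Let B i : 'M[R]_d := gamma_rho D alpha i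
  - (gamma_tau D alpha i)^-1 *: (gamma_nu D i *m (gamma_nu D i)^T).

(** Both kinds of steps at once: the hypothesis on g says that the translation
    gradient at Y is a bounded function of the displacement (for starred steps,
    zero). The gradient blocks at X are then X_i B_i and - theta_i, which are normal
    to the manifold, plus remainders wt and wr that are bounded in X - Y. Pairing them with
    the Riemannian gradient G itself gives sqn G = <w, G>. *)
Lemma argmax_riem_grad_bound (g : 'I_n -> pose_mx R d n -> 'cV[R]_d) :
  (forall i, frob_bounded (g i)) ->
  exists2 C, 0 <= C & forall Y X G,
    (forall i, argmax_SO (theta D alpha M Y i) (rot_of X i)) ->
    (forall i, tr_of (egrad M Y) i = g i (X - Y)) ->
    riem_grad M X G -> sqn G <= C * sqn (X - Y).
Proof.
move=> gb.
pose wt i (H : pose_mx R d n) := g i H + tr_of (egrad M H) i.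
pose wr i (H : pose_mx R d n) := - (rot_of H i *m B i)
  + (gamma_tau D alpha i)^-1 *: (g i H *m (gamma_nu D i)^T) + rot_of (egrad M H) i.
have wtb i : frob_bounded (wt i).
  apply: frob_boundedD => //.
  exact: (frob_bounded_comp (g := fun H => tr_of H i)
    frob_bounded_egrad (frob_bounded_tr_of R d i)).
have wrb i : frob_bounded (wr i).
  apply: frob_boundedD.
    apply: frob_boundedD.
      by apply/frob_boundedN/frob_bounded_mulmx; exact: frob_bounded_rot_of.
    by apply/frob_boundedZ/frob_bounded_mulmx.
  exact: (frob_bounded_comp (g := fun H => rot_of H i)
    frob_bounded_egrad (frob_bounded_rot_of R d i)).
have [Ct Ct0 hCt] := frob_bounded_sum (index_enum 'I_n) wtb.
have [Cr Cr0 hCr] := frob_bounded_sum (index_enum 'I_n) wrb.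
exists (Ct + Cr); first exact: addr_ge0.
move=> Y X G maxX gY [tanG orthG].
have egX : egrad M X = egrad M Y + egrad M (X - Y) by rewrite -egradD subrKC.
have sqG : sqn G = frob_inner (egrad M X) G.
  by apply/eqP; rewrite eq_sym -subr_eq0 -frob_innerNl -frob_innerDl orthG.
suff : 2 * sqn G <= sqn G + (Ct + Cr) * sqn (X - Y) by lra.
rewrite {1}sqG (mulrDl Ct); apply: le_trans (lerD (lexx _) (lerD (hCt _) (hCr _))).
rewrite !frob_inner_blocks -!big_split mulr_sumr /=; apply: ler_sum => i _.
rewrite egX !pose_blockE gY -/(wt i (X - Y)).
have SOX : SO (rot_of X i) by have [] := maxX i.
pose S := (rot_of X i)^T *m rot_of G i.
have skS : S^T = - S.
  by apply/eqP; rewrite -addr_eq0 addrC trmx_mul trmxK; apply/eqP/tanG.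
have defG : rot_of G i = rot_of X i *m S by rewrite mulmxA SOX.1 mul1mx.
have th0 : frob_inner (theta D alpha M Y i) (rot_of G i) = 0.
  by rewrite defG frob_innerC (argmax_SO_stationary (maxX i)).
have symB : (B i)^T = B i.
  by rewrite linearB linearZ /= trmx_mul trmxK gamma_rho_sym.
(* a symmetric matrix is orthogonal to a skew one *)
have b0 : frob_inner (rot_of X i *m B i) (rot_of G i) = 0.
  rewrite defG frob_inner_mull mulmxA (SO_trK SOX) mul1mx.
  have : frob_inner (B i) S = - frob_inner (B i) S.
    rewrite -frob_innerNr -skS /frob_inner trmxK.
    by rewrite -[LHS]mxtrace_tr trmx_mul trmxK symB mxtrace_mulC.
  by lra.
have -> : rot_of (egrad M Y) i + rot_of (egrad M (X - Y)) i =
    rot_of X i *m B i - theta D alpha M Y i + wr i (X - Y).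
  rewrite /theta /theta_common -/(B i) /wr gY !pose_blockE.
  rewrite mulmxDl mulNmx; set u := _ *m B i; set v := _ *m B i.
  set w := _ *: _; set z := rot_of _ _; set y := rot_of _ _.
  by apply/matrixP => k l; rewrite !mxE; ring.
rewrite (frob_innerDl _ (wr i _)) (frob_innerDl (_ *m B i)) frob_innerNl b0 th0 subrr add0r.
have := frob_inner_amgm (wt i (X - Y)) (tr_of G i).
have := frob_inner_amgm (wr i (X - Y)) (rot_of G i).
by lra.
Qed.

(** The translation update, solved for the translation gradient at Y, expresses it
    linearly by the displacement. *)
Lemma step_riem_grad_bound :
  exists2 C, 0 <= C & forall Y X G,
    step D alpha M Y X -> riem_grad M X G -> sqn G <= C * sqn (X - Y).
Proof.
pose g i (H : pose_mx R d n) :=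
  - (gamma_tau D alpha i *: tr_of H i + rot_of H i *m gamma_nu D i).
have gb i : frob_bounded (g i).
  apply/frob_boundedN/frob_boundedD.
    exact/frob_boundedZ/frob_bounded_tr_of.
  exact/frob_bounded_mulmx/frob_bounded_rot_of.
have [C C0 hC] := argmax_riem_grad_bound gb; exists C => // Y X G stpX.
apply: hC => i; first by have [] := stpX i.
have [_ tri] := stpX i; have T0 := gamma_tau_gt0 D i hn halpha.
rewrite /g !pose_blockE tri mulmxBl.
set u := _ *m _; set v := rot_of Y i *m _; set w := tr_of Y i; set z := tr_of _ _.
have T1 : gamma_tau D alpha i != 0 by rewrite gt_eqF.
by apply/matrixP => k l; rewrite !mxE; field.
Qed.

Lemma step_star_riem_grad_bound :
  exists2 C, 0 <= C & forall Y X G, tr_stationary Y ->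
    step_star D alpha M Y X -> riem_grad M X G -> sqn G <= C * sqn (X - Y).
Proof.
have gb (i : 'I_n) : frob_bounded (fun _ : pose_mx R d n => 0 : 'cV[R]_d).
  by exists 0 => // A; rewrite frob_inner0l mul0r.
have [C C0 hC] := argmax_riem_grad_bound gb; exists C => // Y X G stY [maxX _].
apply: hC => i; last exact: stY.
by rewrite theta_tr_stationary.
Qed.

End ElementarySteps.

(** * Null sequences of matrices *)

Section NullSequences.
Variable R : realType.

Lemma cvg0_sqr_le (V : normedModType R) (u : nat -> R) (v : nat -> V) :
  (forall k, `|v k| ^+ 2 <= u k) -> u k @[k --> \oo] --> (0 : R) ->
  v k @[k --> \oo] --> (0 : V).
Proof.
move=> vu /cvgr0Pnorm_lt u0; apply/cvgr0Pnorm_lt => e e0.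
have e20 : 0 < e ^+ 2 by rewrite exprn_gt0.
near=> k; rewrite -(@ltr_pXn2r _ 2) ?nnegrE ?(ltW e0) //.
apply: le_lt_trans (vu k) _; apply: le_lt_trans (ler_norm _) _.
near: k; exact: u0.
Unshelve. all: by end_near. Qed.

Lemma frob_norm_cvg0 m p (A : nat -> 'M[R]_(m, p)) :
  sqn (A k) @[k --> \oo] --> (0 : R) -> frob_norm (A k) @[k --> \oo] --> (0 : R).
Proof.
by apply: (@cvg0_sqr_le R^o) => k; rewrite real_normK ?num_real ?frob_norm_sqr.
Qed.

Lemma mx_norm_sqr_le m p (A : 'M[R]_(m, p)) : `|A| ^+ 2 <= sqn A.
Proof.
rewrite (_ : `|A| = mx_norm A) //.
have [A0|] := eqVneq (mx_norm A) 0; first by rewrite A0 expr0n sqn_ge0.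
move=> /mx_norm_neq0 [[i j] /= Aij].
by rewrite Aij real_normK ?num_real // sqn_entry.
Qed.

Lemma mx_cvg0 m p (A : nat -> 'M[R]_(m, p)) :
  sqn (A k) @[k --> \oo] --> (0 : R) -> A k @[k --> \oo] --> (0 : 'M[R]_(m, p)).
Proof. by apply: cvg0_sqr_le => k; exact: mx_norm_sqr_le. Qed.

End NullSequences.

(** * Inner loops

    The loops are studied for an abstract step relation stp. The predicate S holds
    for the results of steps: it is the manifold for unstarred steps, and the
    manifold with optimal translations for starred ones. *)

Section InnerMethods.
Variables (R : realType) (d n : nat).
Variable stp : pose_mx R d n -> pose_mx R d n -> Prop.
Variable S : pose_mx R d n -> Prop.
Hypothesis stpS : forall Y X, stp Y X -> S X.

Lemma nag_run_state N0 V0 Vm1 s0 V s : S V0 ->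
  nag_run stp N0 V0 Vm1 s0 V s -> forall i, (i <= N0)%N -> S (V i).
Proof. by move=> SV0 [V0E _ run] [|i] iN; [rewrite V0E|exact: stpS (run i iN).2]. Qed.

Lemma gpm_run_state N0 Z0 Z : S Z0 -> gpm_run stp N0 Z0 Z ->
  forall i, (i <= N0)%N -> S (Z i).
Proof. by move=> SZ0 [Z0E run] [|i] iN; [rewrite Z0E|exact: stpS (run i iN)]. Qed.

Lemma nag_run_momentum_ge1 N0 V0 Vm1 s0 V s : 1 <= s0 ->
  nag_run stp N0 V0 Vm1 s0 V s -> forall i, (i <= N0)%N -> 1 <= s i.
Proof.
move=> s01 [_ s0E run]; elim=> [_|i IH iN]; first by rewrite s0E.
rewrite (run i iN).1; have si := IH (ltnW iN).
have : s i <= Num.sqrt (4 * s i ^+ 2 + 1).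
  rewrite -[leLHS](@ger0_norm _ (s i)); last by lra.
  by rewrite -sqrtr_sqr ler_wsqrtr //; have := sqr_ge0 (s i); lra.
lra.
Qed.

Lemma nag_coefficient_le1 (s s' : R) : 1 <= s ->
  s' = (Num.sqrt (4 * s ^+ 2 + 1) + 1) / 2 -> ((s - 1) / s') ^+ 2 <= 1.
Proof.
move=> s1 s'E.
have ss' : s <= s'.
  suff : 2 * s <= Num.sqrt (4 * s ^+ 2 + 1) by rewrite s'E; lra.
  rewrite -[leLHS](@ger0_norm _ (2 * s)); last by lra.
  by rewrite -sqrtr_sqr ler_wsqrtr // exprMn; lra.
have s'0 : 0 < s' by lra.
rewrite expr_le1 ?divr_ge0 ?ler_pdivrMr //; lra.
Qed.

Variables (D : pgo_data R d n) (q : R).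
Hypothesis q_ge0 : 0 <= q.
Hypothesis stp_decrease : forall Y X, S Y -> stp Y X ->
  pgo_obj D X <= pgo_obj D Y - q * sqn (X - Y).

(** Powers of 2 come from sqn (A + B) <= 2 sqn A + 2 sqn B, applied once per step. *)
Lemma gpm_run_decrease N0 Z0 Z : S Z0 -> gpm_run stp N0 Z0 Z ->
  forall i, (i <= N0)%N ->
    pgo_obj D (Z i) <= pgo_obj D Z0 - q / 2 ^+ i * sqn (Z i - Z0).
Proof.
move=> SZ0 run; elim=> [_|i IH iN].
  by rewrite run.1 subrr frob_inner0l mulr0 subr0.
have := stp_decrease (gpm_run_state SZ0 run (ltnW iN)) (run.2 i iN).
have := IH (ltnW iN).
have : sqn (Z i.+1 - Z0) <= 2 * sqn (Z i.+1 - Z i) + 2 * sqn (Z i - Z0).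
  by rewrite -{1 2}(subrKA (Z i)) sqnD_le.
set a := sqn (Z i.+1 - Z0); set b := sqn _; set c := sqn _ => abc h1 h2.
pose q' := q / 2 ^+ i.
have q'0 : 0 <= q' by rewrite divr_ge0 ?exprn_ge0.
have q'q : q' <= q.
  by rewrite ler_pdivrMr ?exprn_gt0 // ler_peMr // exprn_ege1 // ler1n.
have -> : q / 2 ^+ i.+1 = q' / 2 by rewrite exprS invfM mulrCA mulrC /q' mulrC mulrA.
rewrite -/q' in h1.
have : q' / 2 * a <= q' / 2 * (2 * b + 2 * c) by rewrite ler_wpM2l // divr_ge0.
have : q' * b <= q * b by rewrite ler_wpM2r // sqn_ge0.
move: (pgo_obj D (Z i.+1)) (pgo_obj D (Z i)) (pgo_obj D Z0) h1 h2 => x y z.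
move: a b c {abc} => a b c; lra.
Qed.

End InnerMethods.

(** * The outer loop *)

Section OuterMethod.
Variables (R : realType) (d n : nat) (D : pgo_data R d n).
Variable stp : pose_mx R d n -> pose_mx R d n -> Prop.
Variable S : pose_mx R d n -> Prop.
Hypothesis stpS : forall Y X, stp Y X -> S X.
Variables (N0 : nat) (eta delta : R) (X : nat -> pose_mx R d n).
Hypothesis heta : 0 < eta <= 1.
Hypothesis hdelta : 0 <= delta.
Hypothesis SX0 : S (X 0%N).
Hypothesis runX : outer_run D stp N0 eta delta X.

Section Decrease.
Variable q : R.
Hypothesis q_ge0 : 0 <= q.
Hypothesis stp_decrease : forall Y X, S Y -> stp Y X ->
  pgo_obj D X <= pgo_obj D Y - q * sqn (X - Y).

(** F (X k) <= f k is preserved because f k.+1 is a convex combination of f k and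
    F (X k.+1) <= f k. It makes the safeguard step, which descends from F (X k), descend
    from f k as the acceptance test does. *)
Lemma outer_run_averages : exists f : nat -> R,
  [/\ forall k, f k.+1 = (1 - eta) * f k + eta * pgo_obj D (X k.+1),
      cvgn f &
      forall k, pgo_obj D (X k.+1) <=
        f k - Num.min delta (q / 2 ^+ N0) * sqn (X k.+1 - X k)].
Proof.
have [T [a [f [a0 T0 f0 upd]]]] := runX.
set mu := Num.min _ _.
have mu0 : 0 <= mu by rewrite le_min hdelta divr_ge0 // exprn_ge0.
have eta0 : 0 < eta by case/andP: heta.
have eta1 : eta <= 1 by case/andP: heta.
have fE k : f k.+1 = (1 - eta) * f k + eta * pgo_obj D (X k.+1).
  by have [V [s []]] := upd k.
have dec k : S (X k) -> pgo_obj D (X k) <= f k ->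
    S (X k.+1) /\ pgo_obj D (X k.+1) <= f k - mu * sqn (X k.+1 - X k).
  move=> SXk objf; have [V [s [nag]]] := upd k.
  case: ifPn => [acc [_ -> _] _|_ [Z gpm [_ -> _]] _].
    split; first exact: (nag_run_state stpS SXk nag).
    apply: le_trans acc _; rewrite frob_norm_sqr lerD2l lerN2 ler_wpM2r ?sqn_ge0 //.
    by rewrite ge_min lexx.
  split; first exact: (gpm_run_state stpS SXk gpm).
  apply: le_trans (gpm_run_decrease stpS q_ge0 stp_decrease SXk gpm (leqnn N0)) _.
  by rewrite lerB // ler_wpM2r ?sqn_ge0 // ge_min lexx orbT.
have obj_le k : S (X k) -> pgo_obj D (X k) <= f k -> pgo_obj D (X k.+1) <= f k.
  move=> SXk /(dec k SXk) [_ objk1]; apply: le_trans objk1 _.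
  by rewrite gerBl mulr_ge0 ?sqn_ge0.
have inv k : S (X k) /\ pgo_obj D (X k) <= f k.
  elim: k => [|k [SXk objf]]; first by rewrite f0.
  split; first exact: (dec k SXk objf).1.
  rewrite fE -{1}[pgo_obj D _]mul1r -{1}(subrK eta 1) mulrDl lerD2r.
  by apply: ler_wpM2l; [rewrite subr_ge0|exact: obj_le].
exists f; split=> [//||k]; last exact: (dec k (inv k).1 (inv k).2).2.
apply: nonincreasing_is_cvgn.
  apply/nonincreasing_seqP => k; rewrite fE.
  apply: le_trans (_ : _ <= (1 - eta) * f k + eta * f k) _; last first.
    by rewrite -mulrDl subrK mul1r.
  by rewrite lerD2l; apply: ler_wpM2l; [exact: ltW|case: (inv k) => ? ?; exact: obj_le].
exists 0 => _ [k _ <-]; exact: le_trans (pgo_obj_ge0 D _) (inv k).2.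
Qed.

(** The recursion for f, solved for F (X k.+1), expresses it by two consecutive
    averages; this is where eta <> 0 enters. *)
Lemma outer_run_obj_cvg : exists Finf : R, pgo_obj D (X k) @[k --> \oo] --> Finf.
Proof.
have [f [fE cvgf _]] := outer_run_averages.
have eta0 : eta != 0 by rewrite gt_eqF //; case/andP: heta.
exists (eta^-1 * (limn f - (1 - eta) * limn f)).
rewrite -cvg_shiftS.
have -> : (fun k => pgo_obj D (X k.+1)) =
    (fun k => eta^-1 * (f k.+1 - (1 - eta) * f k)).
  by apply: funext => k; rewrite fE addrC addKr mulKf.
apply: cvgMr; apply: cvgB; last exact: cvgMr.
by rewrite (cvg_shiftS f).
Qed.

Lemma outer_run_increment_cvg0 : 0 < q -> 0 < delta ->
  sqn (X k.+1 - X k) @[k --> \oo] --> (0 : R).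
Proof.
move=> q0 delta0; have [f [fE cvgf dec]] := outer_run_averages.
have eta0 : eta != 0 by rewrite gt_eqF //; case/andP: heta.
set mu := Num.min _ _ in dec.
have mu0 : 0 < mu by rewrite lt_min delta0 divr_gt0 // exprn_gt0.
have gap0 : mu^-1 * (eta^-1 * (f k - f k.+1)) @[k --> \oo] --> (0 : R).
  rewrite -[X in _ --> X](mulr0 mu^-1) -(mulr0 eta^-1) -(subrr (limn f)).
  by apply: cvgMr; apply: cvgMr; apply: cvgB => //; rewrite (cvg_shiftS f).
apply: (squeeze_cvgr _ (cvg_cst 0) gap0).
apply: nearW => k; rewrite sqn_ge0 /= ler_pdivlMl //.
have -> : eta^-1 * (f k - f k.+1) = f k - pgo_obj D (X k.+1).
  by rewrite fE; field.
by have := dec k; lra.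
Qed.

End Decrease.

Hypothesis N0E : N0 = 1%N.

(** With N0 = 1 the previous point T is either the last outer iterate but one, or
    the current one after a restart. The index starts at k.+2 so that a previous
    increment exists. *)
Lemma outer_run_single_step k : exists2 Y, stp Y (X k.+2) &
  (exists2 U, S U & exists c, Y = X k.+1 + c *: (X k.+1 - U)) /\
  sqn (X k.+2 - Y) <= 2 * sqn (X k.+2 - X k.+1) + 2 * sqn (X k.+1 - X k).
Proof.
have [T [a [f [a0 T0 f0 upd]]]] := runX.
rewrite N0E in upd.
have inv j : [/\ S (X j), S (T j) & 1 <= a j].
  elim: j => [|j [SX ST aj]]; first by rewrite T0 a0.
  have [V [s [nag]]] := upd j.
  have SV := nag_run_state stpS SX nag.
  case: ifP => [_ [-> -> ->] _|_ [Z gpm [-> -> ->]] _].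
    by split; [exact: SV|exact: SV|exact: (nag_run_momentum_ge1 aj nag)].
  by have SZ := gpm_run_state stpS SX gpm (leqnn 1); split.
have Tk : sqn (X k.+1 - T k.+1) <= sqn (X k.+1 - X k).
  have [V [s [[V0 _ _]]]] := upd k.
  case: ifP => [_ [_ _ ->] _|_ [Z _ [_ -> ->]] _]; first by rewrite /= V0.
  by rewrite subrr frob_inner0l sqn_ge0.
have [SX ST ak] := inv k.+1.
have [V [s [nag]]] := upd k.+1.
case: ifP => [_ [_ -> _] _|_ [Z [Z0 gpm] [_ -> _]] _].
  case: nag => V0 s0 /(_ 0%N isT) [s1 stpV].
  exists (nag_extrapolation (T k.+1) V s 0) => //; rewrite /nag_extrapolation V0.
  split; first by exists (T k.+1) => //; exists ((s 0%N - 1) / s 1%N).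
  set c := _ / _; have c1 : c ^+ 2 <= 1.
    by apply: nag_coefficient_le1 s1; rewrite s0.
  rewrite opprD addrA; apply: le_trans (sqnD_le _ _) _.
  rewrite sqnN frob_innerZl frob_innerZr [c * _]mulrA -expr2 lerD2l.
  have : c ^+ 2 * sqn (X k.+1 - T k.+1) <= 1 * sqn (X k.+1 - T k.+1).
    by rewrite ler_wpM2r ?sqn_ge0.
  lra.
(* a safeguard step is an extrapolation with coefficient 0 *)
exists (X k.+1); first by rewrite -{1}Z0; exact: gpm.
split; first by exists (T k.+1) => //; exists 0; rewrite scale0r addr0.
by have := sqn_ge0 (X k.+1 - X k); have := sqn_ge0 (Z 1%N - X k.+1); lra.
Qed.

Lemma outer_run_riem_grad_cvg0 M C (G : nat -> pose_mx R d n) : 0 <= C ->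
    (forall Y U Z c G', S Y -> S U -> stp (Y + c *: (Y - U)) Z ->
       riem_grad M Z G' -> sqn G' <= C * sqn (Z - (Y + c *: (Y - U)))) ->
    sqn (X k.+1 - X k) @[k --> \oo] --> (0 : R) ->
    (forall k, riem_grad M (X k) (G k)) ->
  sqn (G k) @[k --> \oo] --> (0 : R).
Proof.
move=> C0 bound diff0 gradG; rewrite -cvg_shiftS -cvg_shiftS /=.
have SX k : S (X k.+1).
  case: k => [|k]; last first.
    by have [Y /stpS] := outer_run_single_step k.
  have [T [a [f [_ _ _ /(_ 0%N) [V [s [nag]]]]]]] := runX.
  case: ifP => [_ [_ -> _] _|_ [Z gpm [_ -> _]] _].
    exact: (nag_run_state stpS SX0 nag).
  exact: (gpm_run_state stpS SX0 gpm).
have up0 : C * (2 * sqn (X k.+2 - X k.+1) + 2 * sqn (X k.+1 - X k))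
    @[k --> \oo] --> (0 : R).
  rewrite -[X in _ --> X](mulr0 C) -[X in C * X](addr0 0).
  apply: cvgMr; apply: cvgD; rewrite -[X in _ --> X](mulr0 2); apply: cvgMr => //.
  by rewrite (cvg_shiftS (fun k => sqn (X k.+1 - X k))).
apply: (squeeze_cvgr _ (cvg_cst 0) up0).
apply: nearW => k; rewrite sqn_ge0 /=.
have [Y stpY [[U SU [c YE]] YX]] := outer_run_single_step k.
rewrite YE in stpY YX.
apply: le_trans (bound _ _ _ _ _ (SX k) SU stpY (gradG k.+2)) _.
exact: ler_wpM2l.
Qed.

End OuterMethod.

(** * Convergence of both methods *)

Section Convergence.
Variables (R : realType) (d n : nat) (D : pgo_data R d n).
Variable M : 'M[R]_(pose_dim d n).
Hypothesis hM : form_matrix (pgo_obj D) M.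
Variable alpha : R.
Hypotheses (halpha : 0 <= alpha) (hn : (2 <= n)%N).
Variables (N0 : nat) (eta delta : R).
Hypotheses (heta : 0 < eta <= 1) (hdelta : 0 <= delta).
Variable X : nat -> pose_mx R d n.

(** The common core of the claims: a positive margin is what positive definiteness
    of Gamma - M and positivity of alpha both provide. *)
Definition convergence_with_margin : Prop :=
  (exists Finf : R, pgo_obj D (X k) @[k --> \oo] --> Finf) /\
  forall c, 0 < c -> surrogate_margin D alpha c -> 0 < delta ->
    sqn (X k.+1 - X k) @[k --> \oo] --> (0 : R) /\
    (N0 = 1%N -> forall G : nat -> pose_mx R d n,
      (forall k, riem_grad M (X k) (G k)) ->
      sqn (G k) @[k --> \oo] --> (0 : R)).

Lemma surrogate_margin0 : surrogate_margin D alpha 0.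
Proof.
move=> H; apply: le_trans (surrogate_margin_alpha D alpha H).
by rewrite mul0r mulr_ge0 ?sqn_ge0 // divr_ge0.
Qed.

Lemma agpm_pgo_convergence :
  agpm_pgo D alpha M N0 eta delta X -> convergence_with_margin.
Proof.
move=> [SX0 run]; have stpS := @step_pose_manifold R d n D M alpha.
have dec c : surrogate_margin D alpha c -> forall Y Z, pose_manifold Y ->
    step D alpha M Y Z -> pgo_obj D Z <= pgo_obj D Y - c * sqn (Z - Y).
  by move=> mc Y Z SY; exact: step_decrease.
split.
  exact: (outer_run_obj_cvg stpS heta hdelta SX0 run (lexx 0) (dec 0 surrogate_margin0)).
move=> c c0 mc delta0.
have diff0 := outer_run_increment_cvg0 stpS heta hdelta SX0 run (ltW c0) (dec c mc) c0 delta0.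
split=> // N01 G gradG.
have [C C0 hC] := step_riem_grad_bound D M halpha hn.
apply: (outer_run_riem_grad_cvg0 stpS SX0 run N01 C0 _ diff0 gradG).
by move=> Y U Z a G' _ _; exact: hC.
Qed.

Lemma agpm_pgo_star_convergence :
  agpm_pgo_star D alpha M N0 eta delta X -> convergence_with_margin.
Proof.
move=> [SOX0 optX0 run]; have [Ldag mpL _] := optX0.
pose S Y := pose_manifold Y /\ tr_optimal M Y.
have SX0 : S (X 0%N) by [].
have stpS Y Z : step_star D alpha M Y Z -> S Z.
  by move=> stpZ; split; [exact: step_star_pose_manifold stpZ|case: stpZ].
have [k k0 dec] := step_star_decrease hM halpha hn mpL.
have {}dec c : 0 <= c -> surrogate_margin D alpha c -> forall Y Z, S Y ->
    step_star D alpha M Y Z -> pgo_obj D Z <= pgo_obj D Y - k * c * sqn (Z - Y).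
  by move=> c0 mc Y Z [SOY optY]; exact: dec.
have kc0 c : 0 <= c -> 0 <= k * c by move=> c0; rewrite mulr_ge0 // ltW.
split.
  exact: (outer_run_obj_cvg stpS heta hdelta SX0 run (kc0 0 (lexx 0))
    (dec 0 (lexx 0) surrogate_margin0)).
move=> c c0 mc delta0.
have diff0 := outer_run_increment_cvg0 stpS heta hdelta SX0 run (kc0 c (ltW c0))
  (dec c (ltW c0) mc) (mulr_gt0 k0 c0) delta0.
split=> // N01 G gradG.
have [C C0 hC] := step_star_riem_grad_bound D M alpha.
apply: (outer_run_riem_grad_cvg0 stpS SX0 run N01 C0 _ diff0 gradG).
move=> Y U Z a G' [_ optY] [_ optU]; apply: hC.
by apply: tr_stationary_extrapolation; exact: (tr_optimal_stationary hM).
Qed.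

End Convergence.

Theorem theorem4 (R : realType) (d n : nat) (hd : (1 <= d)%N) (hn : (2 <= n)%N)
    (D : pgo_data R d n)
    (M : 'M[R]_(pose_dim d n)) (hM : form_matrix (pgo_obj D) M)
    (Omega : 'M[R]_(pose_dim d n)) (hOmega : form_matrix (omega_form D) Omega)
    (alpha : R) (halpha : 0 <= alpha)
    (Gamma : 'M[R]_(pose_dim d n)) (hGamma : Gamma = Omega + alpha%:M)
    (N0 : nat) (hN0 : (1 <= N0)%N)
    (eta : R) (heta : 0 < eta <= 1) (delta : R) (hdelta : 0 <= delta)
    (X : nat -> pose_mx R d n)
    (hX : agpm_pgo D alpha M N0 eta delta X \/
          agpm_pgo_star D alpha M N0 eta delta X) :
  [/\ exists Finf : R, pgo_obj D (X k) @[k --> \oo] --> Finf,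
      posdef (Gamma - M) -> 0 < delta ->
        frob_norm (X k.+1 - X k) @[k --> \oo] --> (0 : R),
      posdef (Gamma - M) -> 0 < delta -> N0 = 1%N ->
        forall gradF : nat -> pose_mx R d n,
          (forall k, riem_grad M (X k) (gradF k)) ->
          gradF k @[k --> \oo] --> (0 : pose_mx R d n),
      0 < alpha -> 0 < delta ->
        frob_norm (X k.+1 - X k) @[k --> \oo] --> (0 : R) &
      0 < alpha -> 0 < delta -> N0 = 1%N ->
        forall gradF : nat -> pose_mx R d n,
          (forall k, riem_grad M (X k) (gradF k)) ->
          gradF k @[k --> \oo] --> (0 : pose_mx R d n)].
Proof.
have cvg : convergence_with_margin D M alpha N0 delta X.
  by case: hX => [/agpm_pgo_convergence|/agpm_pgo_star_convergence]; apply.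
have with_alpha : 0 < alpha -> exists2 c, 0 < c & surrogate_margin D alpha c.
  by move=> a0; exists (alpha / 2); [exact: divr_gt0|exact: surrogate_margin_alpha].
have with_posdef : posdef (Gamma - M) ->
    exists2 c, 0 < c & surrogate_margin D alpha c.
  by rewrite hGamma; exact: surrogate_margin_posdef.
have [objcvg concl] := cvg; split=> //.
- move=> /with_posdef[c c0 mc] delta0; exact/frob_norm_cvg0/(concl c c0 mc delta0).1.
- move=> /with_posdef[c c0 mc] delta0 N01 gradF hgrad.
  exact/mx_cvg0/((concl c c0 mc delta0).2 N01 gradF hgrad).
- move=> /with_alpha[c c0 mc] delta0; exact/frob_norm_cvg0/(concl c c0 mc delta0).1.
- move=> /with_alpha[c c0 mc] delta0 N01 gradF hgrad.
  exact/mx_cvg0/((concl c c0 mc delta0).2 N01 gradF hgrad).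
Qed.
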